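(* Let $n\ge 1$ be an integer and let $(a_1,\ldots,a_n)$ be an $n$-tuple of positive integers. Then $(a_1,\ldots,a_n)$ satisfies $M_n(a_1,\ldots,a_n)=\pm S$ (that is, $M_n(a_1,\ldots,a_n)\in\{S,-S\}$) if and only if $(a_1,\ldots,a_n)$ is the quiddity of a notched $3d$-dissection of a convex polygon with $n+1$ vertices.
   Context: For integers $a_1,\ldots,a_n$ put $$M_n(a_1,\ldots,a_n)=\begin{pmatrix} a_n & -1\\ 1 & 0\end{pmatrix}\begin{pmatrix} a_{n-1} & -1\\ 1 & 0\end{pmatrix}\cdots\begin{pmatrix} a_1 & -1\\ 1 & 0\end{pmatrix}\in SL_2(\mathbb{Z}),\qquad S=\begin{pmatrix} 0 & -1\\ 1 & 0\end{pmatrix}.$$ Notched $3d$-dissection (French: 3$d$-dissection échancrée). Let $n\ge 5$ and let $P$ be a convex polygon with $n+1$ vertices. A notched $3d$-dissection of $P$ is a decomposition of $P$ into sub-polygons by diagonals of $P$ that cross only at vertices of $P$, such that: (1) exactly one of the sub-polygons is a quadrilateral; (2) every other sub-polygon of the decomposition has a number of vertices that is a multiple of $3$; (3) the quadrilateral has exactly two of its sides that are sides of $P$, and these two sides have a vertex in common. This common vertex is numbered $0$, and the other vertices of $P$ are then numbered $1,2,\ldots,n$ in counterclockwise order. For $1\le i\le n$, let $a_i$ be the number of sub-polygons whose number of vertices is a multiple of $3$ and which have vertex $i$ as one of their vertices. The sequence $(a_1,\ldots,a_n)$ is the quiddity of the notched $3d$-dissection. (For $n<5$ there are no notched $3d$-dissections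 of a polygon with $n+1$ vertices.) *)

(* Defs.v *)
From HB Require Import structures.
From mathcomp Require Import all_boot all_order all_algebra.
Set Implicit Arguments.
Unset Strict Implicit.
Unset Printing Implicit Defensive.
Import Order.TTheory GRing.Theory Num.Theory.
Local Open Scope ring_scope.

Definition mx2 (a b c d : int) : 'M[int]_2 :=
  \matrix_(i, j) (if i == 0 then if j == 0 then a else b
                  else if j == 0 then c else d).

Definition S_mx : 'M[int]_2 := mx2 0 (-1) 1 0.

(* The mathematical a_1, ..., a_n are tnth a 0, ..., tnth a (n - 1); the factor
   of a_n comes first, whence rev_ord. *)
Definition M_mx n (a : n.-tuple int) : 'M[int]_2 :=
  \prod_(i < n) mx2 (tnth a (rev_ord i)) (-1) 1 0.

Local Open Scope nat_scope.

(* Combinatorial model: the vertices of a convex polygon P with m vertices are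
   the elements of 'I_m, in counterclockwise order.  A segment joining two
   vertices is the pair (i, j) with i < j.  A polygon whose vertices are among
   those of P is its vertex set A : {set 'I_m}, its boundary visiting A in
   cyclic order; P itself is [set: 'I_m]. *)

Definition segments m (A : {set 'I_m}) : {set 'I_m * 'I_m} :=
  [set e | [&& e.1 \in A, e.2 \in A & e.1 < e.2]].

(* e joins cyclically consecutive vertices of A: one of the two open arcs cut
   out by e contains no vertex of A. *)
Definition sides m (A : {set 'I_m}) : {set 'I_m * 'I_m} :=
  [set e in segments A | [forall k in A, ~~ (e.1 < k < e.2)]
                      || [forall k in A, e.1 <= k <= e.2]].

Definition diagonals m (A : {set 'I_m}) : {set 'I_m * 'I_m} :=
  segments A :\: sides A.

(* In a convex polygon, two segments meet at a point other than a vertex iff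
   their endpoints strictly interlace. *)
Definition crossing m (e f : 'I_m * 'I_m) : bool :=
  (e.1 < f.1 < e.2) && (e.2 < f.2) || (f.1 < e.1 < f.2) && (f.2 < e.2).

Definition dissection m (D : {set 'I_m * 'I_m}) : Prop :=
  D \subset diagonals [set: 'I_m] /\ {in D &, forall e f, ~~ crossing e f}.

(* The pieces into which the diagonals in D cut P: the polygons bounded by
   sides of P and elements of D, and not cut further by an element of D. *)
Definition subpolygons m (D : {set 'I_m * 'I_m}) : {set {set 'I_m}} :=
  [set A : {set 'I_m} | [&& 3 <= #|A|,
                            sides A \subset sides [set: 'I_m] :|: D
                          & [disjoint diagonals A & D]]].

(* Q is the quadrilateral, and v is the common vertex of the two sides of P that
   are sides of Q. *)
Definition notched_3d_dissection n (D : {set 'I_n.+1 * 'I_n.+1})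
    (v : 'I_n.+1) : Prop :=
  [/\ 5 <= n, dissection D &
      exists Q : {set 'I_n.+1},
        [/\ [set A in subpolygons D | #|A| == 4] = [set Q],
            {in subpolygons D, forall A, A != Q -> 3 %| #|A|},
            #|sides Q :&: sides [set: 'I_n.+1]| = 2 &
            {in sides Q :&: sides [set: 'I_n.+1],
              forall e, (v == e.1) || (v == e.2)}]].

(* Here the common vertex is assumed to be ord0, so that the other vertices are
   already numbered 1, ..., n; vertex j + 1 is lift ord0 j for j : 'I_n. *)
Definition quiddity n (D : {set 'I_n.+1 * 'I_n.+1}) (j : 'I_n) : nat :=
  #|[set A in subpolygons D | (3 %| #|A|) && (lift ord0 j \in A)]|.

Definition is_quiddity n (D : {set 'I_n.+1 * 'I_n.+1}) (a : n.-tuple int) :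
    Prop :=
  forall j : 'I_n, tnth a j = Posz (quiddity D j).

(* Main.v *)
Require Import Defs.
From HB Require Import structures.
From mathcomp Require Import all_boot all_order all_algebra.
From mathcomp Require Import zify ring.
Set Implicit Arguments.
Unset Strict Implicit.
Unset Printing Implicit Defensive.
Import Order.TTheory GRing.Theory Num.Theory.
Local Open Scope ring_scope.

(** The quadrilateral of a notched 3d-dissection has vertices [0, 1, k, n], so
    such a dissection is a pair of 3d-dissected polygons, on [1..k] and on
    [k..n], glued at [k].  Write [U x] for the factor of [M_n] attached to [x].
    - Since [U (x + y) = - U y S U x], gluing along a vertex adds weights and
      multiplies the matrices with a factor [- S] in between; as [U 1 ^ 3 = -1],
      a polygon with [3 d] vertices contributes [U 1 ^ (3 d) = +-1], and an
      induction over the pieces gives [M = +-1] for one 3d-dissected polygon and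
      [M = +-S] for two glued ones.
    - Conversely, if all interior entries of a positive sequence are at least 2,
      the continuants increase, which excludes [+-1] and [+-S].  So some interior
      entry is 1, and up to the boundary cases [(1, 1, 1)] for [+-1], and
      [(1, 1, y, ...)], [(..., y, 1, 1)] with [y >= 2] for [+-S], the sequence
      contains [(x + 1, 1, y + 1)] or [(w, 1, 1, y)].  Replacing these by [(x, y)]
      and by [(w + y - 1)] preserves [M] up to sign; backwards, this glues a
      triangle on a side, or enlarges by three vertices the [w]-th piece around
      a vertex. *)

(** * Action of continuant matrices on pairs of integers *)

(** The matrix [mx2 a (-1) 1 0] applied to a column; [step 0] is [S_mx]. On pairs, matrix identities
    become polynomial identities for [ring]. *)
Definition step (a : int) (v : int * int) : int * int := (a * v.1 - v.2, v.1).

Definition opp2 (v : int * int) : int * int := (- v.1, - v.2).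

(** The leftmost entry acts first, as [a_1] belongs to the rightmost factor of [M_mx]. *)
Definition act (s : seq nat) (v : int * int) : int * int :=
  foldl (fun w (a : nat) => step a%:Z w) v s.

Arguments act : simpl never.

(** For linear maps this is equality in [PSL_2]: one sign serves for all vectors. *)
Definition eqpm (g h : int * int -> int * int) : Prop :=
  (forall v, g v = h v) \/ (forall v, g v = opp2 (h v)).

Lemma act_cat s t v : act (s ++ t) v = act t (act s v).
Proof. by rewrite /act foldl_cat. Qed.

Lemma act_cons a s v : act (a :: s) v = act s (step a%:Z v).
Proof. by []. Qed.

Lemma opp2K : involutive opp2.
Proof. by case=> u v; rewrite /opp2 /= !opprK. Qed.

Lemma step_opp2 a v : step a (opp2 v) = opp2 (step a v).
Proof. by case: v => u v; rewrite /step /opp2 /=; congr pair; ring. Qed.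

Lemma act_opp2 s v : act s (opp2 v) = opp2 (act s v).
Proof. by elim: s v => //= a s IH v; rewrite !act_cons step_opp2 IH. Qed.

Lemma act_lin s u v :
  act s (u, v) = (u * (act s (1, 0)).1 + v * (act s (0, 1)).1,
                  u * (act s (1, 0)).2 + v * (act s (0, 1)).2).
Proof.
elim/last_ind: s => [|s a IH]; first by rewrite /= ; congr pair; ring.
rewrite -cats1 !act_cat IH /= /act /= /step /=.
by congr pair; ring.
Qed.

Lemma eqpm_trans g h k : eqpm g h -> eqpm h k -> eqpm g k.
Proof.
move=> [E|E] [E'|E']; [left|right|right|left] => v; rewrite E E' //.
by rewrite opp2K.
Qed.

(** The last entry of [s] and the first of [t] belong to the vertex shared by two polygons, where
    the numbers of pieces add up. *)
Fixpoint glue (s t : seq nat) : seq nat :=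
  if s is x :: s' then
    if s' is [::] then (x + head 0 t)%N :: behead t else x :: glue s' t
  else t.

Lemma glue_cons x s t : s != [::] -> glue (x :: s) t = x :: glue s t.
Proof. by case: s. Qed.

Lemma act_glue s t : s != [::] -> t != [::] ->
  forall v, act (glue s t) v = opp2 (act t (step 0 (act s v))).
Proof.
case: t => // y t; elim: s => // x s IH _ _ v.
case: s IH => [|x' s] IH.
  rewrite /= !act_cons -act_opp2 -step_opp2; congr (act t _).
  by rewrite /act /step /opp2 /=; congr pair; ring.
by rewrite act_cons -[RHS]/(opp2 (act _ (step 0 (act (x' :: s) (step x%:Z v))))) -IH.
Qed.

Lemma size_glue s t : s != [::] -> t != [::] ->
  size (glue s t) = (size s + size t).-1.
Proof.
case: t => // y t; elim: s => // x [|x' s] IH _ _ //.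
by rewrite glue_cons // /size -!/(size _) IH //=; lia.
Qed.

(** Past the end of [s] the first summand is the default 0; both summands are read only at the
    merged index [(size s).-1]. *)
Lemma nth_glue s t j : s != [::] -> t != [::] ->
  nth 0 (glue s t) j =
  (nth 0 s j + (if j < (size s).-1 then 0 else nth 0 t (j - (size s).-1)))%N.
Proof.
case: t => // y t; elim: s j => // x [|x' s] IH j _ _.
  by case: j => [|j] /=; rewrite ?nth_nil ?subn0.
case: j => [|j]; first by rewrite /= addn0.
by rewrite glue_cons // [LHS]/= IH //= ltnS subSS.
Qed.

(* A chain is a path of consecutive links between vertices i, ..., i + width:
   [Side] is a link made of one side, [Piece c _] a link cut off by a chord,
   under which lies the polygon whose other sides are the links of [c]. *)

Lemma mx2_mul a b c d a' b' c' d' :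
  mx2 a b c d * mx2 a' b' c' d' =
  mx2 (a * a' + b * c') (a * b' + b * d') (c * a' + d * c') (c * b' + d * d').
Proof.
apply/matrixP => i j; rewrite !mxE big_ord_recl big_ord1 !mxE.
by case: i j => [[|[|//]] ?] [[|[|//]] ?].
Qed.

Lemma mx2_inj a b c d a' b' c' d' : mx2 a b c d = mx2 a' b' c' d' ->
  [/\ a = a', b = b', c = c' & d = d'].
Proof.
move/matrixP => E.
by have := (E 0 0, E 0 1, E 1 0, E 1 1); rewrite !mxE /= => -[[[-> ->] ->] ->].
Qed.

Lemma mx2_opp a b c d : - mx2 a b c d = mx2 (- a) (- b) (- c) (- d).
Proof. by apply/matrixP => i j; rewrite !mxE; case: ifP; case: ifP. Qed.

Lemma M_mx_act n (a : n.-tuple int) (s : seq nat) : map Posz s = a ->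
  M_mx a = mx2 (act s (1, 0)).1 (act s (0, 1)).1 (act s (1, 0)).2 (act s (0, 1)).2.
Proof.
move=> Es.
have -> : M_mx a = \prod_(x <- rev [seq Posz x | x <- s]) mx2 x (-1) 1 0.
  rewrite (big_nth 0) size_rev Es size_tuple big_mkord; apply: eq_bigr => i _.
  by rewrite nth_rev ?size_tuple // (tnth_nth 0) /=.
elim/last_ind: s {a Es} => [|s x IH].
  rewrite big_nil /act /=; apply/matrixP => i j; rewrite !mxE.
  by case: i j => [[|[|//]] ?] [[|[|//]] ?].
rewrite map_rcons rev_rcons big_cons IH mx2_mul -cats1 !act_cat /act /step /=.
by congr mx2; ring.
Qed.

Lemma M_mx_S n (a : n.-tuple int) (s : seq nat) : map Posz s = a ->
  (M_mx a = S_mx \/ M_mx a = - S_mx) <-> eqpm (act s) (step 0).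
Proof.
move=> Es; rewrite (M_mx_act Es) /S_mx mx2_opp; split.
  by case=> /mx2_inj[E1 E2 E3 E4]; [left|right] => -[u v];
    rewrite act_lin E1 E2 E3 E4 /step /opp2 /=; congr pair; ring.
by case=> E; [left|right]; rewrite !E.
Qed.

(** * Chains of polygons and their weights *)

Inductive chain := Stop | Side of chain | Piece of chain & chain.

Fixpoint links (f : chain) : nat :=
  match f with Stop => 0 | Side g => (links g).+1 | Piece _ g => (links g).+1 end.

Fixpoint width (f : chain) : nat :=
  match f with
  | Stop => 0
  | Side g => (width g).+1
  | Piece c g => (width c + width g)%N
  end.

Fixpoint all_pieces (P : pred nat) (f : chain) : bool :=
  match f with
  | Stop => true
  | Side g => all_pieces P g
  | Piece c g => [&& P (links c), all_pieces P c & all_pieces P g]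
  end.

Definition add_head (b : nat) (s : seq nat) : seq nat :=
  if s is x :: t then (b + x)%N :: t else [::].

(* The number of pieces at each vertex, where the ends of the links of [f] count
   [b] more: [b = 1] when the links are the sides of a piece, and [0] at top
   level, as the quadrilateral is not counted. *)
Fixpoint weights (b : nat) (f : chain) : seq nat :=
  match f with
  | Stop => [:: b]
  | Side g => b :: weights b g
  | Piece c g => add_head b (glue (weights 1 c) (weights b g))
  end.

Lemma weights_neq0 b f : weights b f != [::].
Proof.
elim: f b => //= c IHc g IHg b.
by case: (weights 1 c) (IHc 1%N) => //= x [|y s].
Qed.

Lemma size_weights b f : size (weights b f) = (width f).+1.
Proof.
elim: f b => //= [g IH b|c IHc g IHg b]; first by rewrite IH.
have E : size (glue (weights 1 c) (weights b g)) = (width c + width g).+1.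
  by rewrite size_glue ?weights_neq0 // IHc IHg; lia.
by case: glue E => //= x s ->.
Qed.

(** The chord that cuts a piece off is one more side, so [r] links bound a polygon with [r + 1]
    sides. *)
Definition is3d : pred nat := fun r => (r %% 3 == 2)%N.

Lemma iter_step1 k v : iter (3 * k) (step 1) v = iter k opp2 v.
Proof.
elim: k v => // k IH v; rewrite mulnS addnC iterD IH [iter 3 _ _]/=.
have -> : step 1 (step 1 (step 1 v)) = opp2 v.
  by case: v => x y; rewrite /step /opp2 /=; congr pair; ring.
by rewrite -iterSr.
Qed.

(** Each piece contributes plus or minus the identity and drops out; what remains is one factor
    [U b] for each of the [links f + 1] ends of links. *)
Lemma act_weights b f : all_pieces is3d f ->
  eqpm (act (weights b f)) (iter (links f).+1 (step b%:Z)).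
Proof.
elim: f b => [b _|g IH b /IH Hg|c IHc g IHg b /and3P[/eqP Pc /IHc Hc /IHg Hg]].
- by left.
- have [E|E] := Hg b; [left|right] => v.
    by rewrite [weights _ _]/= act_cons E -iterSr.
  by rewrite [weights _ _]/= act_cons E -iterSr.
(* Under the chord each corner counts 1, and [links c + 1] is a multiple of 3, so a power of
   [U 1 ^ 3 = -1] is left. *)
have Hc1 : eqpm (act (weights 1 c)) id.
  apply: eqpm_trans (Hc 1%N) _.
  have -> : (links c).+1 = (3 * ((links c).+1 %/ 3))%N by lia.
  elim: (_ %/ 3)%N => [|k IHk]; first by left.
  have E v : iter (3 * k.+1) (step 1) v = opp2 (iter (3 * k) (step 1) v).
    by rewrite !iter_step1.
  by case: IHk => E'; [right|left] => v; rewrite E E' // opp2K.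
have Ec : eqpm (act (glue (weights 1 c) (weights b g)))
               (fun v => act (weights b g) (step 0 v)).
  case: Hc1 => E; [right|left] => v.
    by rewrite act_glue ?weights_neq0 // E.
  by rewrite act_glue ?weights_neq0 // E step_opp2 act_opp2 opp2K.
have Eb : eqpm (act (weights b (Piece c g)))
               (fun v => act (weights b g) (step b%:Z v)).
  have nz : glue (weights 1 c) (weights b g) != [::].
    by rewrite -size_eq0 size_glue ?weights_neq0 // !size_weights; lia.
  rewrite [weights _ _]/=.
  (* Adding [b] at the head amounts to gluing [[:: b]] in front; the factors [S] of the two gluings
     then cancel up to sign. *)
  have -> : add_head b (glue (weights 1 c) (weights b g)) =
            glue [:: b] (glue (weights 1 c) (weights b g)).
    by case: glue nz.
  have E0 v : step 0 (step 0 v) = opp2 v.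
    by case: v => x y; rewrite /step /opp2 /=; congr pair; ring.
  case: Ec => E; [left|right] => v; rewrite act_glue // E /=.
    by rewrite -!act_opp2 E0 opp2K.
  by rewrite -!act_opp2 E0 opp2K.
apply: eqpm_trans Eb _.
by case: (Hg b) => E; [left|right] => v; rewrite E -iterSr.
Qed.

(** * Local moves: a triangle glued on a side, a piece enlarged by three vertices *)

Local Open Scope nat_scope.

(** The effect on weights of a triangle glued on the side from position [i] to [i + 1]. *)
Fixpoint ear_at (i : nat) (s : seq nat) : seq nat :=
  match i, s with
  | 0, x :: y :: t => x.+1 :: 1 :: y.+1 :: t
  | i'.+1, x :: t => x :: ear_at i' t
  | _, _ => s
  end.

(** This undoes the replacement of [(w, 1, 1, y)] by [x = w + y - 1], whence the last new entry
    [x - w + 1]. *)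
Fixpoint split_at (i w : nat) (s : seq nat) : seq nat :=
  match i, s with
  | 0, x :: t => w :: 1 :: 1 :: (x - w).+1 :: t
  | i'.+1, x :: t => x :: split_at i' w t
  | _, _ => s
  end.

Arguments glue : simpl never.

Lemma glue1 x t : glue [:: x] t = x + head 0 t :: behead t.
Proof. by []. Qed.

Lemma ear_at_glue_l i s t : i.+1 < size s ->
  ear_at i (glue s t) = glue (ear_at i s) t.
Proof.
elim: i s => [|i IH] [|x [|y s]] //; first by case: s => [|z s].
move=> lt_i; rewrite glue_cons //= IH //.
by case: i {IH} lt_i => [|i]; case: s.
Qed.

Lemma ear_at_glue_r i s t : s != [::] -> (size s).-1 <= i ->
  i < ((size s).-1 + size t).-1 ->
  ear_at i (glue s t) = glue s (ear_at (i - (size s).-1) t).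
Proof.
elim: s i => // x [|x' s] IH i _.
  move=> {IH}; case: t => // y t; rewrite /= subn0 !glue1.
  by case: i => [|i] //; case: t => //= z t; rewrite addnS.
case: i => // i Hi Hi'; rewrite glue_cons // [ear_at _ _]/= IH //.
by move: Hi' => /=; lia.
Qed.

(** The merged vertex is included: if [w] is at most the entry of [s], the cut falls among the
    pieces of [s], and the head of [t] stays with the right copy. *)
Lemma split_at_glue_l i w s t : i < size s -> w <= nth 0 s i ->
  split_at i w (glue s t) = glue (split_at i w s) t.
Proof.
elim: i s => [|i IH] [|x s] // lt_i le_w.
  case: s {lt_i} le_w => [|y s] le_w; last first.
    by rewrite [split_at 0 w (x :: _)]/= !(@glue_cons _ (_ :: _)).
  rewrite glue1 [split_at 0 w [:: x]]/= 3?glue_cons // glue1 /=.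
  by congr [:: _, _, _, _ & _]; move: le_w => /=; lia.
have nz : s != [::] by case: (s) lt_i.
by rewrite glue_cons //= IH // glue_cons //; case: (i) (s) nz => [|j] [].
Qed.

(** At the merged vertex the pieces of [s] come first, so a cut after all of them is a cut in [t],
    with [w] lowered by their number. *)
Lemma split_at_glue_mid w s t : s != [::] -> t != [::] ->
  last 0 s <= w ->
  split_at (size s).-1 w (glue s t) = glue s (split_at 0 (w - last 0 s) t).
Proof.
elim: s => // x [|x' s] IH _ nzt le_w.
  case: t nzt {IH} => // y t _.
  by rewrite !glue1; move: le_w => /= le_w; congr [:: _, _, _, _ & _]; lia.
rewrite !(@glue_cons x (x' :: s)) //.
by rewrite -[RHS]/(x :: glue _ (split_at 0 (w - last 0 (x' :: s)) t)) -IH.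
Qed.

Lemma split_at_glue_r i w s t : s != [::] -> (size s).-1 < i ->
  split_at i w (glue s t) = glue s (split_at (i - (size s).-1) w t).
Proof.
elim: s i => // x [|x' s] IH i _.
  by move=> {IH}; case: i => // i _; rewrite subn0 !glue1 /=; case: t => //=; case: i.
by case: i => // i Hi; rewrite glue_cons // [split_at _ _ _]/= IH.
Qed.

Lemma ear_at_add_head b i s : i.+1 < size s ->
  ear_at i (add_head b s) = add_head b (ear_at i s).
Proof. by case: i s => [|i] [|x [|y s]] //= _; rewrite addnS. Qed.

(** Positions [i] and [i + 1] are joined by a [Side] at some depth; the link
    [Piece (Side (Side Stop))] takes its place. *)
Lemma chain_ear b f i : i < width f ->
  exists f', [/\ weights b f' = ear_at i (weights b f), links f' = links f &
                 all_pieces is3d f -> all_pieces is3d f'].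
Proof.
elim: f b i => [|g IH|c IHc g IHg] b i //=.
  case: i => [_|i lt_i].
    exists (Piece (Side (Side Stop)) g); split=> //=.
    have := weights_neq0 b g; case: (weights b g) => //= y t _.
    by rewrite addn1.
  have [g' [Eg Lg Ag]] := IH b i lt_i.
  by exists (Side g'); split=> //=; rewrite ?Eg ?Lg.
move=> lt_i.
have Sc := size_weights 1 c; have Sg := size_weights b g.
have Sgl : size (glue (weights 1 c) (weights b g)) = (width c + width g).+1.
  by rewrite size_glue ?weights_neq0 // Sc Sg; lia.
rewrite ear_at_add_head ?Sgl //.
have [lt_c|le_c] := ltnP i (width c).
  have [c' [Ec Lc Ac]] := IHc 1 i lt_c.
  exists (Piece c' g); split=> //=.
    by rewrite Ec ear_at_glue_l // Sc.
  by rewrite Lc => /and3P[-> /Ac -> ->].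
have [|g' [Eg Lg Ag]] := IHg b (i - width c); first by lia.
exists (Piece c g'); split=> //=; last 2 first.
- by rewrite Lg.
- by move=> /and3P[-> -> /Ag ->].
by rewrite Eg ear_at_glue_r ?weights_neq0 ?Sc ?Sg //=; lia.
Qed.

(* Around a vertex the pieces are ordered from its left neighbour to its right
   neighbour; the [w]-th one gets three more vertices, so that the left copy of
   the vertex keeps the first [w] pieces.  Unless this piece is the one counted
   by [b], the number of links is unchanged. *)
Lemma chain_split b f i w : b <= 1 -> i <= width f ->
  0 < w <= nth 0 (weights b f) i ->
  exists f', [/\ weights b f' = split_at i w (weights b f),
                 links f' = links f %[mod 3], b = 0 -> links f' = links f &
                 all_pieces is3d f -> all_pieces is3d f'].
Proof.
move=> b1; elim: f b b1 i w => [|g IH|c IHc g IHg] b b1 i w /=.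
- case: i => //= _ /andP[w_gt0 w_le]; have -> : w = b by lia.
  have -> : b = 1 by lia.
  by exists (Side (Side (Side Stop))).
- case: i => [_ /= /andP[w_gt0 w_le]|i lt_i /= Hw].
    have -> : w = b by lia. have -> : b = 1 by lia.
    by exists (Side (Side (Side (Side g)))); split=> //=; lia.
  have [g' [Eg Lg Lg0 Ag]] := IH b b1 i w lt_i Hw.
  exists (Side g'); split=> //=; first by rewrite Eg.
    by lia.
  by move/Lg0 ->.
move=> le_i.
have Sc := size_weights 1 c; have Sg := size_weights b g.
have nzc := weights_neq0 1 c; have nzg := weights_neq0 b g.
set s := glue (weights 1 c) (weights b g).
have nzs : s != [::] by rewrite -size_eq0 size_glue // Sc Sg; lia.
(* The same claim before the head receives its extra [b]; the cut is passed on to [c] or to [g]. *)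
have key w' : 0 < w' <= nth 0 s i -> exists f',
    [/\ weights b f' = add_head b (split_at i w' s),
        links f' = (links g).+1 %[mod 3], b = 0 -> links f' = (links g).+1 &
        [&& is3d (links c), all_pieces is3d c & all_pieces is3d g] ->
        all_pieces is3d f'].
  move=> /andP[w_gt0]; rewrite nth_glue // Sc /=.
  have use_c : i <= width c -> w' <= nth 0 (weights 1 c) i -> exists f',
      [/\ weights b f' = add_head b (split_at i w' s),
        links f' = (links g).+1 %[mod 3], b = 0 -> links f' = (links g).+1 &
        [&& is3d (links c), all_pieces is3d c & all_pieces is3d g] ->
        all_pieces is3d f'].
    move=> le_ic le_w; have [|c' [Ec Lc _ Ac]] := IHc 1 isT i w' le_ic.
      by rewrite w_gt0.
    exists (Piece c' g); split=> //=.
      by rewrite Ec /s split_at_glue_l // Sc.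
    by rewrite /is3d Lc => /and3P[-> /Ac -> ->].
  have use_g w2 : 0 < w2 <= nth 0 (weights b g) (i - width c) ->
      split_at i w' s = glue (weights 1 c) (split_at (i - width c) w2 (weights b g)) ->
      exists f', [/\ weights b f' = add_head b (split_at i w' s),
        links f' = (links g).+1 %[mod 3], b = 0 -> links f' = (links g).+1 &
        [&& is3d (links c), all_pieces is3d c & all_pieces is3d g] ->
        all_pieces is3d f'].
    move=> Hw2 Es; have [|g' [Eg Lg Lg0 Ag]] := IHg b b1 (i - width c) w2 _ Hw2.
      by lia.
    exists (Piece c g'); split=> /=; first by rewrite Eg Es.
    - by lia.
    - by move/Lg0 ->.
    - by move=> /and3P[-> -> /Ag ->].
  have [lt_ic|lt_ci|Ei] := ltngtP i (width c).
  - by rewrite addn0 => le_w; apply: use_c; lia.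
  - rewrite nth_default ?Sc // add0n => le_w; apply: (use_g w'); first by lia.
    by rewrite /s split_at_glue_r // Sc.
  - have E0 : i - width c = 0 by lia.
    rewrite E0 => le_w; have [le_wc|lt_cw] := leqP w' (nth 0 (weights 1 c) i).
      by apply: use_c => //; rewrite Ei.
    have El : last 0 (weights 1 c) = nth 0 (weights 1 c) i.
      by rewrite -nth_last Sc Ei.
    apply: (use_g (w' - nth 0 (weights 1 c) i)); first by rewrite E0; lia.
    have Ei' : i = (size (weights 1 c)).-1 by rewrite Sc.
    by rewrite -El E0 {1}Ei' split_at_glue_mid // El ltnW.
case: i le_i key => [|i] le_i key; last first.
  by case: s nzs key => // x t _ key /key.
(* At the left end the piece counted by [b] comes first. If it is the one to enlarge, three sides
   are put in front; otherwise [key] applies with [w] lowered by [b]. *)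
have [le_wb|lt_bw] := leqP w b.
  move=> /andP[w_gt0 _]; have Eb : b = 1 by lia.
  have -> : w = 1 by lia.
  exists (Side (Side (Side (Piece c g)))); split=> //=; last by rewrite Eb.
  by rewrite -/s Eb; case: (s) nzs => //= x t _; rewrite add1n subn1.
move: key; rewrite -/s; case: (s) nzs => // x t _ key /=.
move=> /andP[w_gt0 le_w]; have [|f' [Ef Lf Lf0 Af]] := key (w - b).
  by move=> /=; lia.
by exists f'; split=> //; rewrite Ef /=; congr [:: _, _, _, _ & _]; lia.
Qed.

(** * Reducing a positive solution *)

(** The positivity conditions keep the entries positive after the reduction to [(x, y)] or to
    [(w + y - 1)]. *)
Definition reducible (a : seq nat) : Prop :=
  (exists p x y t, [/\ 0 < x, 0 < y & a = p ++ [:: x.+1, 1, y.+1 & t]]) \/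
  (exists p w y t, [/\ 0 < w, 0 < y & a = p ++ [:: w, 1, 1, y & t]]).

Lemma reducible_cons x a : reducible a -> reducible (x :: a).
Proof.
by case=> [[p [u [y [t [? ? ->]]]]]|[p [u [y [t [? ? ->]]]]]]; [left|right];
  exists (x :: p), u, y, t.
Qed.

(** The first 1 in [m] follows an entry at least 2. If its successor is at least 2, the first
    pattern occurs; if it is 1, a further entry gives the second pattern, and no further entry
    leaves the third case. *)
Lemma reducible_scan l m y : 2 <= l -> all (leq 1) m -> 0 < y ->
  [\/ reducible (l :: rcons m y), all (leq 2) m |
      exists m', [/\ m = rcons m' 1, all (leq 2) m' & y = 1]].
Proof.
elim: m l => [|z m IH] l l2; first by constructor 2.
move=> /= /andP[z1 pm] y1; case: (ltnP 1 z) => [z2|z_le1].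
  have [R|A|[m' [-> A ->]]] := IH z z2 pm y1.
  - by constructor 1; apply: reducible_cons.
  - by constructor 2.
  - by constructor 3; exists (z :: m'); rewrite /= z2.
have {z1 z_le1}-> : z = 1 by lia.
case: m {IH} pm => [_|z2 m /= /andP[z2_gt0 pm]].
  have [->|y_neq1] := eqVneq y 1; first by constructor 3; exists [::].
  constructor 1; left; exists [::], l.-1, y.-1, [::]; rewrite /=.
  by split; [lia|lia|congr [:: _; _; _]; lia].
constructor 1; have [->|z2_neq1] := eqVneq z2 1.
  right; exists [::]; case: m pm => [_|z3 m /= /andP[? _]].
    by exists l, y, [::]; split=> //; lia.
  by exists l, z3, (rcons m y); split=> //; lia.
left; exists [::], l.-1, z2.-1, (rcons m y); rewrite /=.
by split; [lia|lia|congr [:: _, _, _ & _]; lia].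
Qed.

(** The first entry sends [(0, 1)] to [(-1, 0)]; then [a >= 2] and [v < u] give [u < a u - v], so
    the order of the coordinates persists. *)
Lemma act_ge2 x m : all (leq 2) m -> exists u v : int,
  [/\ act (x :: m) (0, 1)%R = (- u, - v)%R, (0 <= v)%R, (v < u)%R &
      m != [::] -> (0 < v)%R].
Proof.
elim/last_ind: m => [_|m a IH].
  by exists 1%R, 0%R; split=> //; rewrite act_cons /act /step /= mulr0.
rewrite all_rcons => /andP[a2 /IH[u [v [E v0 vu _]]]].
exists (a%:Z * u - v)%R, u; split; [|by lia|by nia|by move=> _; lia].
rewrite -rcons_cons -cats1 act_cat E act_cons /act /step /=.
by congr pair; ring.
Qed.

Lemma eqpm_at g h v : eqpm g h -> g v = h v \/ g v = opp2 (h v).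
Proof. by case=> E; [left|right]; apply: E. Qed.

Lemma reducible_id a : all (leq 1) a -> a != [::] -> eqpm (act a) id ->
  reducible a \/ a = [:: 1; 1; 1].
Proof.
case: a => // x m /= /andP[x1 pm] _.
elim/last_ind: m pm => [_ Ha|m y _].
  by move: (eqpm_at (0, 1)%R Ha) => [[]|[]].
rewrite all_rcons => /andP[y1 pm] Ha.
(* Otherwise the first coordinate of the image of [(0, 1)] would be [-(y u - v)], nonzero because
   [v < u]. *)
have no_ge2 : ~~ all (leq 2) m.
  apply/negP=> /(act_ge2 x)[u [v [E v0 vu _]]].
  move: (eqpm_at (0, 1)%R Ha).
  rewrite -rcons_cons -cats1 act_cat E act_cons /act /step /opp2 /=.
  by case=> -[]; nia.
(* A final [1, 1] turns [(-u, -v)] into [(v, v - u)], so [v = 0] and only [(x, 1, 1)] is left. *)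
have no_ge2_1 m' : m = rcons m' 1 -> all (leq 2) m' -> y = 1 -> m' = [::] /\ x = 1.
  move=> Em A Ey; have [u [v [E v0 vu v1]]] := act_ge2 x A.
  have Em' : m' = [::].
    apply/eqP; apply: contraT => /v1 v_gt0; move: (eqpm_at (0, 1)%R Ha).
    rewrite Em Ey -2!rcons_cons -!cats1 -catA act_cat E act_cons /act /step /opp2 /=.
    by case=> -[]; lia.
  split=> //; move: (eqpm_at (1, 0)%R Ha).
  rewrite Em Em' Ey /act /step /opp2 /=.
  by case=> -[]; lia.
have [x2|x_le1] := ltnP 1 x.
  have [R|A|[m' [Em A Ey]]] := reducible_scan x2 pm y1; first by left.
    by rewrite A in no_ge2.
  by have [_ Ex] := no_ge2_1 _ Em A Ey; rewrite Ex in x2.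
have Ex : x = 1 by lia.
case: m no_ge2 no_ge2_1 pm Ha => // z m no_ge2 no_ge2_1 /andP[z1 pm] Ha.
have [z2|z_le1] := ltnP 1 z.
  have [R|A|[m' [Em A Ey]]] := reducible_scan z2 pm y1.
  - by left; apply: reducible_cons.
  - by rewrite /= z2 A in no_ge2.
  - have E1 : z :: m = rcons (z :: m') 1 by rewrite Em.
    have E2 : all (leq 2) (z :: m') by rewrite /= z2.
    by have [] := no_ge2_1 _ E1 E2 Ey.
have Ez : z = 1 by lia.
subst x z; clear z1 z_le1; case: m no_ge2 no_ge2_1 pm Ha => [|z m] no_ge2 no_ge2_1.
  move=> _ Ha; right; congr [:: _; _; _]; move: (eqpm_at (0, 1)%R Ha).
  by rewrite /act /step /opp2 /=; case=> -[]; lia.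
move=> /andP[z1 pm] Ha; left.
have [z2|z_le1] := ltnP 1 z; last first.
  have -> : z = 1 by lia.
  right; exists [::], 1; case: m pm {no_ge2 no_ge2_1 Ha} => [|w m] /=.
    by exists y, [::].
  by move=> /andP[w1 _]; exists w, (rcons m y).
(* Two leading ones send [(1, 0)] to [(0, 1)], so that [act_ge2] applies from [z] on. *)
have E0 : act [:: 1; 1] (1, 0)%R = (0, 1)%R by [].
have [R|A|[m' [Em A Ey]]] := reducible_scan z2 pm y1.
- by do 2!apply: reducible_cons.
- have [u [v [E v0 vu _]]] := act_ge2 z A; move: (eqpm_at (1, 0)%R Ha).
  rewrite -[1 :: _]/([:: 1; 1] ++ rcons (z :: m) y) act_cat E0 -cats1 act_cat E.
  by rewrite /act /step /opp2 /=; case=> -[]; lia.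
- have [u [v [E v0 vu _]]] := act_ge2 z A; move: (eqpm_at (1, 0)%R Ha).
  rewrite -[1 :: _]/([:: 1; 1] ++ rcons (z :: m) y) act_cat E0 Em Ey.
  rewrite -rcons_cons -!cats1 -catA act_cat E.
  by rewrite /act /step /opp2 /=; case=> -[]; lia.
Qed.

(** The scan is that of [reducible_id]. A boundary pair [1, 1] next to an entry at least 2 is now
    possible; it will be matched to a triangle. *)
Lemma reducible_S a : all (leq 1) a -> eqpm (act a) (step 0) ->
  [\/ reducible a, exists y t, 0 < y /\ a = [:: 1, 1, y.+1 & t] |
      exists p y, 0 < y /\ a = p ++ [:: y.+1; 1; 1]].
Proof.
case: a => [_ Ha|x m /= /andP[x1 pm]].
  by move: (eqpm_at (1, 0)%R Ha) => [[]|[]].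
elim/last_ind: m pm => [_ Ha|m y _].
  move: (eqpm_at (1, 0)%R Ha); rewrite /act /step /opp2 /=.
  by case=> -[]; lia.
rewrite all_rcons => /andP[y1 pm] Ha.
have no_ge2 : ~~ all (leq 2) m.
  apply/negP=> /(act_ge2 x)[u [v [E v0 vu _]]].
  move: (eqpm_at (0, 1)%R Ha).
  rewrite -rcons_cons -cats1 act_cat E act_cons /act /step /opp2 /=.
  by case=> -[]; nia.
(* The entry before the final [1, 1] is at least 2, be it [l] or the last one of [m']. *)
have special p l m' : 2 <= l -> all (leq 2) m' -> exists q z,
    0 < z /\ p ++ rcons (rcons (l :: m') 1) 1 = q ++ [:: z.+1; 1; 1].
  move=> l2 A; exists (p ++ belast l m'), (last l m').-1; split.
    by case/lastP: m' A => [|m' z] /=; rewrite ?last_rcons ?all_rcons; lia.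
  rewrite -!cats1 -!catA [l :: m']lastI -cats1 -!catA /= prednK //.
  by case/lastP: m' A => [|m' z] /=; rewrite ?last_rcons ?all_rcons; lia.
have [x2|x_le1] := ltnP 1 x.
  have [R|A|[m' [Em A Ey]]] := reducible_scan x2 pm y1; first by constructor 1.
    by rewrite A in no_ge2.
  by constructor 3; have := special [::] _ _ x2 A; rewrite Em Ey.
have Ex : x = 1 by lia.
case: m no_ge2 pm Ha => // z m no_ge2 /andP[z1 pm] Ha.
have [z2|z_le1] := ltnP 1 z.
  have [R|A|[m' [Em A Ey]]] := reducible_scan z2 pm y1.
  - by constructor 1; apply: reducible_cons.
  - by rewrite /= z2 A in no_ge2.
  - by constructor 3; have := special [:: x] _ _ z2 A; rewrite Em Ey.
have Ez : z = 1 by lia.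
subst x z; clear z1 z_le1; case: m no_ge2 pm Ha => [_ _ Ha|z m _ /andP[z1 pm] Ha].
  move: (eqpm_at (0, 1)%R Ha).
  by rewrite /act /step /opp2 /=; case=> -[]; lia.
have [z2|z_le1] := ltnP 1 z.
  by constructor 2; exists z.-1, (rcons m y); split; [lia | rewrite prednK].
have -> : z = 1 by lia.
constructor 1; right; exists [::], 1; case: m pm {Ha} => [|w m] /=.
  by exists y, [::].
by move=> /andP[w1 _]; exists w, (rcons m y).
Qed.

(** This is [U (y + 1) U 1 U (x + 1) = U y U x]. *)
Lemma act_ear p x y t v :
  act (p ++ [:: x.+1, 1, y.+1 & t]) v = act (p ++ [:: x, y & t]) v.
Proof.
rewrite !act_cat !act_cons; congr (act t _).
by case: (act p v) => u w; rewrite /step /=; congr pair; ring.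
Qed.

(** This is [U y U 1 U 1 U w = - U (w + y - 1)]. *)
Lemma act_split p w y t v : 0 < w + y ->
  act (p ++ [:: w, 1, 1, y & t]) v = opp2 (act (p ++ (w + y).-1 :: t) v).
Proof.
move=> wy; rewrite -act_opp2 !act_cat !act_cons; congr (act t _).
rewrite act_opp2; case: (act p v) => u u'.
rewrite /step /opp2 /=; have -> : ((w + y).-1%:Z = w%:Z + y%:Z - 1)%R by lia.
by congr pair; ring.
Qed.

Lemma ear_at_cat p x y t :
  ear_at (size p) (p ++ [:: x, y & t]) = p ++ [:: x.+1, 1, y.+1 & t].
Proof. by elim: p => //= z p ->. Qed.

Lemma split_at_cat p w y t : 0 < y ->
  split_at (size p) w (p ++ (w + y).-1 :: t) = p ++ [:: w, 1, 1, y & t].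
Proof.
move=> y0; elim: p => [|z p /= ->] //=.
by congr [:: _, _, _, _ & _]; lia.
Qed.

(* The two local moves lower the length and preserve positivity, and both lift
   to chains. *)
Lemma chain_of_reducible b k g (a : seq nat) :
    (forall a' : seq nat, size a' < size a -> a' != [::] -> all (leq 1) a' ->
       eqpm (act a') g ->
       exists f, [/\ weights b f = a', all_pieces is3d f,
                     links f = k %[mod 3] & b = 0 -> links f = k]) ->
    b <= 1 -> all (leq 1) a -> eqpm (act a) g -> reducible a ->
  exists f, [/\ weights b f = a, all_pieces is3d f,
                links f = k %[mod 3] & b = 0 -> links f = k].
Proof.
move=> IH b1 pa Ha [[p [x [y [t [x0 y0 Ea]]]]]|[p [w [y [t [w0 y0 Ea]]]]]].
  have [||||f [Wf Af Lf Lf0]] := IH (p ++ [:: x, y & t]).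
  - by rewrite Ea !size_cat /=; lia.
  - by case: (p).
  - by move: pa; rewrite Ea !all_cat /= x0 y0 => /andP[-> ->].
  - by case: Ha => E; [left|right] => v; rewrite -E Ea act_ear.
  have Ew : (width f).+1 = size (p ++ [:: x, y & t]) by rewrite -Wf size_weights.
  have [|f' [Wf' Lf' Af']] := @chain_ear b f (size p).
    by move: Ew; rewrite size_cat /=; lia.
  exists f'; rewrite Wf' Lf' Wf ear_at_cat -Ea; split=> //; exact: Af'.
have wy : 0 < w + y by lia.
have [||||f [Wf Af Lf Lf0]] := IH (p ++ (w + y).-1 :: t).
- by rewrite Ea !size_cat /=; lia.
- by case: (p).
- by move: pa; rewrite Ea !all_cat /= => /and3P[-> _ /andP[_ ->]]; lia.
- case: Ha => E; [right|left] => v.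
    by rewrite -E Ea act_split // opp2K.
  by have := E v; rewrite Ea act_split // => /(can_inj opp2K).
have Ew : (width f).+1 = size (p ++ (w + y).-1 :: t) by rewrite -Wf size_weights.
have [||f' [Wf' Lf' Lf0' Af']] := @chain_split b f (size p) w b1.
- by move: Ew; rewrite size_cat /=; lia.
- by rewrite Wf nth_cat ltnn subnn /=; lia.
exists f'; split; [|exact: Af'|by rewrite Lf'|by move=> b0; rewrite Lf0' // Lf0].
by rewrite Wf' Wf split_at_cat // Ea.
Qed.

Lemma chain_of_id a : all (leq 1) a -> a != [::] -> eqpm (act a) id ->
  exists c, [/\ weights 1 c = a, all_pieces is3d c & is3d (links c)].
Proof.
move=> pa nza Ha.
(* The number of links is tracked only modulo 3, since enlarging the outer piece, counted by
   [b = 1], adds three links. *)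
suff [c [Wc Ac Lc _]] : exists f, [/\ weights 1 f = a, all_pieces is3d f,
    links f = 2 %[mod 3] & 1 = 0 -> links f = 2].
  by exists c; split=> //; rewrite /is3d Lc.
elim: {a}(size a) {-2}a (leqnn (size a)) pa nza Ha => [|N IH] a.
  by case: a.
move=> sz pa nza Ha; have [R|->] := reducible_id pa nza Ha; last first.
  by exists (Side (Side Stop)).
apply: chain_of_reducible Ha R => // a' lt_a nz' p' H'.
by apply: IH => //; lia.
Qed.

Lemma glue0 s : s != [::] -> glue s [:: 0] = s.
Proof.
elim: s => // x [|y s] IH _; first by rewrite glue1 /= addn0.
by rewrite glue_cons // IH.
Qed.

(** The two links are the sides of the quadrilateral that avoid vertex [0], and [b = 0] because the
    quadrilateral is not counted. *)
Lemma chain_of_S a : all (leq 1) a -> eqpm (act a) (step 0) ->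
  exists f, [/\ weights 0 f = a, all_pieces is3d f & links f = 2].
Proof.
move=> pa Ha.
suff [c [Wc Ac _ Lc]] : exists f, [/\ weights 0 f = a, all_pieces is3d f,
    links f = 2 %[mod 3] & 0 = 0 -> links f = 2].
  by exists c; split=> //; apply: Lc.
elim: {a}(size a) {-2}a (leqnn (size a)) pa Ha => [|N IH] a sz pa Ha.
  by case: a sz Ha {pa} => // _ Ha; move: (eqpm_at (1, 0)%R Ha) => [[]|[]].
have U13 v : step 1 (step 1 (step 1 v)) = opp2 v.
  by case: v => x y; rewrite /step /opp2 /=; congr pair; ring.
have [R|[y [t [y0 Ea]]]|[p [y [y0 Ea]]]] := reducible_S pa Ha.
- apply: chain_of_reducible Ha R => // a' lt_a nz' p' H'.
  by apply: IH => //; lia.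
(* Since [U (y + 1) U 1 U 1 = U y S], the sequence [y :: t] gives plus or minus the identity; the
   first polygon is a triangle. *)
- have Hy : eqpm (act (y :: t)) id.
    have E v : act a v = act (y :: t) (step 0 v).
      rewrite Ea !act_cons; congr (act t _).
      by case: v => u w; rewrite /step /=; congr pair; ring.
    have Ev v : v = step 0 (opp2 (step 0 v)).
      by case: v => u w; rewrite /step /opp2 /=; congr pair; ring.
    case: Ha => H; [left|right] => v; rewrite [in LHS](Ev v) -E H -?Ev //.
  have [||c [Wc Ac Lc]] := chain_of_id _ _ Hy => //.
    by move: pa; rewrite Ea /= y0.
  exists (Piece (Side (Side Stop)) (Piece c Stop)); split=> //=.
    by rewrite Wc glue0 // !(glue_cons, glue1) // Ea.
  by rewrite Lc Ac.
(* Symmetrically [U 1 U 1 U (y + 1) = S U y], and the second polygon is a triangle. *)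
- have Hy : eqpm (act (rcons p y)) id.
    have E v : act a v = step 0 (act (rcons p y) v).
      rewrite Ea -cats1 !act_cat; case: (act p v) => u w.
      by rewrite /act /step /=; congr pair; ring.
    have Ev v : v = opp2 (step 0 (step 0 v)).
      by case: v => u w; rewrite /step /opp2 /=; congr pair; ring.
    case: Ha => H; [left|right] => v; rewrite [in LHS](Ev (act _ _)) -E H.
      by rewrite -Ev.
    by rewrite step_opp2 -Ev.
  have [||c [Wc Ac Lc]] := chain_of_id _ _ Hy => //.
  + by move: pa; rewrite Ea all_rcons all_cat y0 => /andP[].
  + by case: (p).
  exists (Piece c (Piece (Side (Side Stop)) Stop)); split=> //=; last by rewrite Lc Ac.
  rewrite Wc Ea glue0 // -[X in glue _ X]/([:: 1; 1; 1]).
  have -> q : glue (rcons q y) [:: 1; 1; 1] = q ++ [:: y.+1; 1; 1].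
    elim: q => [|x q IHq]; first by rewrite glue1 /= addn1.
    by rewrite rcons_cons glue_cons ?IHq //; case: (q).
  by case: (p).
Qed.

(** * Vertex sets of the pieces of a chain *)

Fixpoint corners (f : chain) (i : nat) : seq nat :=
  match f with
  | Stop => [:: i]
  | Side g => i :: corners g i.+1
  | Piece c g => i :: corners g (i + width c)
  end.

Fixpoint polys (f : chain) (i : nat) : seq (seq nat) :=
  match f with
  | Stop => [::]
  | Side g => polys g i.+1
  | Piece c g => corners c i :: polys c i ++ polys g (i + width c)
  end.

(** For a piece, listed in increasing order, this is the chord that cuts it off. *)
Definition base (p : seq nat) : nat * nat := (head 0 p, last 0 p).

Definition chords (f : chain) (i : nat) : seq (nat * nat) :=
  map base (polys f i).

Lemma head_corners f i : head 0 (corners f i) = i.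
Proof. by case: f. Qed.

Lemma last_corners f i x : last x (corners f i) = i + width f.
Proof.
elim: f i x => /= [|g IH|c _ g IH] i x; rewrite ?addn0 // IH; first by lia.
by rewrite addnA.
Qed.

Lemma size_corners f i : size (corners f i) = (links f).+1.
Proof. by elim: f i => //= [g IH|c _ g IH] i; rewrite IH. Qed.

Lemma base_corners f i : base (corners f i) = (i, i + width f).
Proof. by rewrite /base head_corners last_corners. Qed.

Lemma chords_Side g i : chords (Side g) i = chords g i.+1.
Proof. by []. Qed.

Lemma chords_Piece c g i : chords (Piece c g) i =
  (i, i + width c) :: chords c i ++ chords g (i + width c).
Proof. by rewrite /chords /= base_corners map_cat. Qed.

Lemma links_width f : all_pieces (leq 2) f -> links f <= width f.
Proof. by elim: f => //= c IHc g IHg /and3P[? /IHc ? /IHg]; lia. Qed.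

Lemma corners_range f i (x : nat) : x \in corners f i -> i <= x <= i + width f.
Proof.
elim: f i => /= [|g IH|c _ g IH] i; rewrite inE; first by lia.
  by case/predU1P => [->|/IH]; lia.
by case/predU1P => [->|/IH]; lia.
Qed.

Lemma mem_corners0 f i : i \in corners f i.
Proof. by case: f => *; rewrite mem_head. Qed.

Lemma polys_range f i p (x : nat) : p \in polys f i -> x \in p -> i <= x <= i + width f.
Proof.
elim: f i => //= [g IH|c IHc g IHg] i; first by move=> /IH /[apply]; lia.
rewrite inE mem_cat => /predU1P[->|/orP[/IHc|/IHg]].
- by move/corners_range; lia.
- by move/[apply]; lia.
- by move/[apply]; lia.
Qed.

Lemma sorted_corners f i : all_pieces (leq 2) f -> sorted ltn (corners f i).
Proof.
have path_corners j g : sorted ltn (corners g j) -> forall k, k < j ->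
    path ltn k (corners g j).
  by case: g => [|g|c g] /= H k ->.
elim: f i => //= [g IH|c _ g IH] i; first by move/(IH i.+1)/path_corners; apply.
move=> /and3P[l2 Ac /(IH (i + width c))/path_corners]; apply.
by have := links_width Ac; lia.
Qed.

Lemma sorted_polys f i p : all_pieces (leq 2) f -> p \in polys f i ->
  sorted ltn p /\ 2 < size p.
Proof.
elim: f i => //= [g IH|c IHc g IHg] i; first exact: IH.
move=> /and3P[l2 Ac Ag]; rewrite inE mem_cat => /predU1P[->|/orP[/IHc|/IHg]].
- by rewrite sorted_corners // size_corners.
- exact.
- exact.
Qed.

Lemma chords_range f i (e : nat * nat) : all_pieces (leq 2) f -> e \in chords f i ->
  [/\ i <= e.1, e.1.+1 < e.2 & e.2 <= i + width f].
Proof.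
elim: f i => // [g IH|c IHc g IHg] i.
  by rewrite chords_Side => /= /IH /[apply] -[? ? ?]; split; lia.
rewrite chords_Piece => /= /and3P[l2 Ac Ag].
have := links_width Ac; rewrite inE mem_cat => w2 /predU1P[->|/orP[|]] /=.
- by split; lia.
- by move=> /(IHc _ Ac)[? ? ?]; split; lia.
- by move=> /(IHg _ Ag)[? ? ?]; split; lia.
Qed.

(** Every chord lies under a single link, and the corners are the ends of links. *)
Lemma corners_uncovered f i (e : nat * nat) (x : nat) :
  all_pieces (leq 2) f -> e \in chords f i ->
  x \in corners f i -> ~~ (e.1 < x < e.2).
Proof.
elim: f i => // [g IH|c IHc g IHg] i.
  rewrite chords_Side /= => Ag Ie; rewrite inE => /predU1P[->|]; last exact: IH.
  by have [] := chords_range Ag Ie; lia.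
rewrite chords_Piece => /= /and3P[l2 Ac Ag].
have := links_width Ac; rewrite !inE mem_cat => w2.
move=> /predU1P[->|/orP[/(chords_range Ac)[? ? ?]|Ie]] /= /predU1P[->|Ix].
- by lia.
- by have := corners_range Ix; lia.
- by lia.
- by have := corners_range Ix; lia.
- by have [? ? ?] := chords_range Ag Ie; lia.
- exact: IHg Ix.
Qed.

Lemma corners_side f i (x y : nat) : all_pieces (leq 2) f ->
  x \in corners f i -> y \in corners f i -> x < y ->
  (forall k, k \in corners f i -> ~~ (x < k < y)) ->
  y = x.+1 \/ (x, y) \in chords f i.
Proof.
elim: f i => [|g IH|c _ g IH] i.
- by rewrite !inE => _ /eqP-> /eqP->; lia.
- rewrite chords_Side !inE => Ag /= /predU1P[->|Ix] /predU1P[->|Iy] lt_xy nb.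
  + by lia.
  + left; have := nb i.+1; rewrite inE mem_corners0 orbT => /(_ isT).
    by have := corners_range Iy; lia.
  + by have := corners_range Ix; lia.
  + by apply: (IH _ Ag Ix Iy lt_xy) => k Ik; apply: nb; rewrite inE Ik orbT.
rewrite chords_Piece !inE => /= /and3P[l2 Ac Ag].
have := links_width Ac; rewrite mem_cat => w2.
move=> /predU1P[->|Ix] /predU1P[->|Iy] lt_xy nb.
- by lia.
- right; have := nb (i + width c); rewrite inE mem_corners0 orbT => /(_ isT).
  have := corners_range Iy => R N; apply/orP; left; apply/eqP; congr pair; lia.
- by have := corners_range Ix; lia.
- have [||] := IH _ Ag Ix Iy lt_xy; [|by left|by move=> ->; right; rewrite !orbT].
  by move=> k Ik; apply: nb; rewrite inE Ik orbT.
Qed.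

Lemma polys_side f i p (x y : nat) : all_pieces (leq 2) f -> p \in polys f i ->
  x \in p -> y \in p -> x < y -> (forall k, k \in p -> ~~ (x < k < y)) ->
  y = x.+1 \/ (x, y) \in chords f i.
Proof.
elim: f i => // [g IH|c IHc g IHg] i /=; first exact: IH.
move=> /and3P[l2 Ac Ag]; rewrite chords_Piece inE mem_cat => Hp Ix Iy lt_xy nb.
rewrite inE mem_cat; case/predU1P: Hp => [E|/orP[Hp|Hp]].
- rewrite E in Ix Iy nb; have [|->] := corners_side Ac Ix Iy lt_xy nb; first by left.
  by right; rewrite orbT.
- by have [|->] := IHc _ Ac Hp Ix Iy lt_xy nb; [left|right; rewrite orbT].
- by have [|->] := IHg _ Ag Hp Ix Iy lt_xy nb; [left|right; rewrite !orbT].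
Qed.

(** A chord joining two vertices of a piece is one of its links or its base, so no chord cuts a
    piece. *)
Lemma polys_diagonal f i p (x y : nat) : all_pieces (leq 2) f -> p \in polys f i ->
  x \in p -> y \in p -> x < y -> (x, y) \in chords f i ->
  (forall k, k \in p -> ~~ (x < k < y)) \/ (forall k, k \in p -> x <= k <= y).
Proof.
elim: f i => // [g IH|c IHc g IHg] i /=; first exact: IH.
move=> /and3P[l2 Ac Ag]; rewrite chords_Piece !inE !mem_cat => Hp Ix Iy lt_xy.
case/predU1P: Hp => [E|/orP[Hp|Hp]]; move=> /predU1P[[Ex Ey]|/orP[He|He]].
- by right=> k; rewrite E Ex Ey => /corners_range.
- by left=> k; rewrite E => /(corners_uncovered Ac He).
- have [/= ? _ _] := chords_range Ag He.
  by move: Iy; rewrite E => /corners_range; lia.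
- by right=> k /(polys_range Hp); rewrite Ex Ey.
- exact: IHc Hp Ix Iy lt_xy He.
- have [/= ? _ _] := chords_range Ag He.
  by have := polys_range Hp Iy; lia.
- by have := polys_range Hp Ix; have := links_width Ac; lia.
- have [/= _ _ ?] := chords_range Ac He.
  by have := polys_range Hp Ix; lia.
- exact: IHg Hp Ix Iy lt_xy He.
Qed.

Lemma chords_noncrossing f i (e e' : nat * nat) : all_pieces (leq 2) f ->
  e \in chords f i -> e' \in chords f i ->
  ~~ [&& e.1 < e'.1, e'.1 < e.2 & e.2 < e'.2].
Proof.
elim: f i => // [g IH|c IHc g IHg] i /=; first exact: IH.
move=> /and3P[l2 Ac Ag]; rewrite chords_Piece !inE !mem_cat.
have R h j (d : nat * nat) : all_pieces (leq 2) h -> d \in chords h j ->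
    j <= d.1 /\ d.2 <= j + width h by move=> Ah /(chords_range Ah)[].
move=> /predU1P[->|/orP[He|He]] /predU1P[->|/orP[He'|He']] //=; first by lia.
- by have := R _ _ _ Ac He'; lia.
- by have := R _ _ _ Ag He'; lia.
- by have := R _ _ _ Ac He; lia.
- exact: IHc He He'.
- by have := R _ _ _ Ac He; have := R _ _ _ Ag He'; lia.
- by have := R _ _ _ Ag He; lia.
- by have := R _ _ _ Ag He; have := R _ _ _ Ac He'; lia.
- exact: IHg He He'.
Qed.

(** With at least two links there is an inner corner, which the full chord would cover. *)
Lemma full_chord_notin f i : all_pieces (leq 2) f -> 2 <= links f ->
  (i, i + width f) \notin chords f i.
Proof.
case: f => [//|g|c g] Af l2; apply/negP => He.
  by have [/= ? _ _] := @chords_range g i.+1 _ Af He; lia.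
have /and3P[l2c Ac Ag] := Af.
have Ix : i + width c \in corners (Piece c g) i by rewrite inE mem_corners0 orbT.
have := corners_uncovered Af He Ix.
by move: l2; have := links_width Ac; have := links_width Ag => /=; lia.
Qed.

Lemma uniq_chords f i : all_pieces (leq 2) f -> uniq (chords f i).
Proof.
elim: f i => // [g IH|c IHc g IHg] i; first exact: IH.
rewrite chords_Piece => /and3P[l2 Ac Ag].
have := links_width Ac => w2.
rewrite cons_uniq mem_cat cat_uniq IHc // IHg // andbT negb_or -andbA.
apply/and4P; split=> //; first exact: full_chord_notin.
  by apply/negP => /(chords_range Ag)[/=]; lia.
apply/hasPn => e /(chords_range Ag)[? ? ?]; apply/negP => /(chords_range Ac)[].
by lia.
Qed.

(** This turns the weights obtained by gluing into the counting used in [quiddity]. *)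
Lemma nth_weights b f i j : all_pieces (leq 2) f ->
  nth 0 (weights b f) j =
  b * (i + j \in corners f i) + count (fun p : seq nat => i + j \in p) (polys f i).
Proof.
elim: f b i j => [|g IH|c IHc g IHg] b i j /=.
- move=> _; rewrite inE addn0; case: j => [|j] /=; first by rewrite addn0 eqxx muln1.
  by rewrite nth_nil (_ : _ == _ = false) ?muln0 //; lia.
- move=> Ag; case: j => [|j] /=; last first.
    rewrite (IH b i.+1) // addnS inE -addSn; congr (b * _ + _).
    by rewrite (_ : _ == _ = false) //; lia.
  rewrite addn0 mem_head muln1 (eq_in_count (a2 := pred0)) ?count_pred0 ?addn0 //.
  by move=> p /polys_range R; apply/negP => /R; lia.
move=> /and3P[l2 Ac Ag]; have w2 := links_width Ac.
have -> s : nth 0 (add_head b s) j = b * (j == 0) * (s != [::]) + nth 0 s j.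
  case: s j => [|x s] [|j] //=; rewrite ?nth_nil ?muln0 ?muln1 //.
rewrite nth_glue ?weights_neq0 // size_weights /= count_cat.
rewrite (IHc 1 i j Ac) mul1n inE.
have -> : glue (weights 1 c) (weights b g) != [::].
  by rewrite -size_eq0 size_glue ?weights_neq0 // !size_weights; lia.
have [lt_jc|le_cj] := ltnP j (width c).
  rewrite [count _ (polys g _)](eq_in_count (a2 := pred0)) ?count_pred0 ?addn0; last first.
    by move=> p /polys_range R; apply/negP => /R; lia.
  rewrite (_ : i + j \in corners g _ = false); last by apply/negP => /corners_range; lia.
  by rewrite orbF muln1 (_ : (i + j == i) = (j == 0)) // -{2}[i]addn0 eqn_add2l.
rewrite (IHg b (i + width c)) // (_ : i + width c + (j - width c) = i + j); last by lia.
rewrite (_ : j == 0 = false); last by lia.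
rewrite (_ : i + j == i = false); last by lia.
by rewrite /=; lia.
Qed.

(** * Subpolygons of a dissection *)

Lemma sidesP m (A : {set 'I_m}) (x y : 'I_m) :
  reflect [/\ x \in A, y \in A, x < y &
              (forall k, k \in A -> ~~ (x < k < y)) \/
              (forall k, k \in A -> x <= k <= y)]
          ((x, y) \in sides A).
Proof.
rewrite !inE /=; apply: (iffP idP).
  by case/andP=> /and3P[Ax Ay ->] /orP[] /'forall_implyP H; split=> //; [left|right].
by case=> -> -> -> /= [] H; apply/orP; [left|right]; apply/'forall_implyP.
Qed.

Lemma sides_setTP n (x y : 'I_n.+1) :
  reflect (x < y /\ (y = x.+1 :> nat \/ x = 0 :> nat /\ y = n :> nat))
          ((x, y) \in sides [set: 'I_n.+1]).
Proof.
apply: (iffP (sidesP _ _ _)) => [[_ _ lt_xy H]|[lt_xy H]].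
  split=> //; case: H => H.
    left; have lt_x : x.+1 < n.+1 by have := ltn_ord y; lia.
    by have := H (Ordinal lt_x) (in_setT _) => /=; lia.
  right; have /= := H ord0 (in_setT _); have /= := H ord_max (in_setT _).
  by have := ltn_ord y; lia.
split; rewrite ?inE //; case: H => [E|[E1 E2]]; [left|right] => k _; first by lia.
by have := ltn_ord k; lia.
Qed.

Lemma subpolygonsP m (D : {set 'I_m * 'I_m}) (A : {set 'I_m}) :
  reflect [/\ 2 < #|A|,
              forall x y, (x, y) \in sides A ->
                (x, y) \in sides [set: 'I_m] \/ (x, y) \in D &
              forall x y, x \in A -> y \in A -> x < y -> (x, y) \in D ->
                (x, y) \in sides A]
          (A \in subpolygons D).
Proof.
rewrite inE; apply: (iffP and3P) => -[cA sA dA]; split=> //.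
- by move=> x y /(subsetP sA); rewrite inE => /orP.
- move=> x y Ax Ay lt_xy Dxy; have := disjointFl dA Dxy.
  by rewrite !inE /= Ax Ay lt_xy /= andbT => /negbFE.
- by apply/subsetP => -[x y] /sA; rewrite in_setU => -[->|->]; rewrite ?orbT.
- rewrite disjoint_sym disjoint_subset; apply/subsetP => -[x y] Dxy.
  rewrite inE in_setD; apply/negP => /andP[/negP Ns]; rewrite inE => /and3P[Ax Ay lt_xy].
  by apply: Ns; apply: dA.
Qed.

Lemma third_element m (A : {set 'I_m}) x y : 2 < #|A| ->
  exists2 k, k \in A & (k != x) && (k != y).
Proof.
move=> cA; have /subsetPn[k Ak] : ~~ (A \subset [set x; y]).
  by apply: contraL cA => /subset_leq_card; rewrite cards2; lia.
by rewrite !inE negb_or; exists k.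
Qed.

(** Here [u] and [v] are the vertices of [A] nearest to [z] on either side. *)
Lemma side_around m (A : {set 'I_m}) (z a b : 'I_m) :
  z \notin A -> a \in A -> b \in A -> a < z -> z < b ->
  exists u v : 'I_m, [/\ (u, v) \in sides A, forall k, k \in A -> ~~ (u < k < v) &
                          [/\ a <= u, u < z, z < v & v <= b]].
Proof.
move=> Nz Aa Ab az zb.
case: (@arg_maxnP _ a (fun k => (k \in A) && (k < z)) val); first by rewrite Aa.
move=> u /andP[Au uz] max_u.
case: (@arg_minnP _ b (fun k => (k \in A) && (z < k)) val); first by rewrite Ab.
move=> v /andP[Av zv] min_v; exists u, v.
have gap k : k \in A -> ~~ (u < k < v).
  move=> Ak; have := max_u k; have := min_v k; rewrite Ak /=.
  have : val k != val z by apply: contraNneq Nz => /val_inj <-.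
  by rewrite /=; lia.
split=> //; first by apply/sidesP; split=> //; [lia|left].
by split=> //; [apply: max_u; rewrite Aa | apply: min_v; rewrite Ab].
Qed.

Lemma noncrossingP m (D : {set 'I_m * 'I_m}) (x y z w : 'I_m) :
  {in D &, forall e f, ~~ crossing e f} ->
  (x, y) \in D -> (z, w) \in D -> ~~ [&& x < z, z < y & y < w].
Proof.
by move=> nc Dxy Dzw; have := nc _ _ Dxy Dzw; rewrite /crossing /=; lia.
Qed.

(* If [x] in [A] is not in [B], the side [(z, w)] of [B] around [x] is a chord.
   Either [A] has a side crossing it, or [z] and [w] are vertices of [A] and the
   chord cuts [A]. *)
Lemma subpolygons_subset n (D : {set 'I_n.+1 * 'I_n.+1}) (A B : {set 'I_n.+1})
    (a b : 'I_n.+1) :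
    {in D &, forall e f, ~~ crossing e f} ->
    A \in subpolygons D -> B \in subpolygons D ->
    a \in A -> b \in A -> a \in B -> b \in B ->
    (forall k, k \in A -> a <= k <= b) -> (forall k, k \in B -> a <= k <= b) ->
  A \subset B.
Proof.
move=> ncD /subpolygonsP[cA sA dA] /subpolygonsP[cB sB dB] Aa Ab Ba Bb hA hB.
apply/subsetP => x Ax; apply/negPn/negP => Bx.
have neq_val (u v : 'I_n.+1) (E : {set 'I_n.+1}) :
    u \in E -> v \notin E -> val u != val v.
  by move=> Eu; apply: contraNneq => /val_inj <-.
have := hA x Ax; have := neq_val _ _ _ Ba Bx; have := neq_val _ _ _ Bb Bx => /= xb xa hx.
have [||z [w [Szw gap [az zx xw wb]]]] := side_around Bx Ba Bb; [by lia|by lia|].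
have [Bz Bw zw _] := sidesP _ _ _ Szw.
have [k Bk /andP[kz kw]] := third_element z w cB.
have kz' : val k != val z by []. have kw' : val k != val w by [].
have out : ~~ (z <= k <= w) by move: (gap k Bk) kz' kw'; clear -zw => /=; lia.
(* A side of [P] is excluded, because [x] lies strictly between [z] and [w] while the third vertex
   [k] of [B] lies outside. *)
have Dzw : (z, w) \in D.
  case: (sB _ _ Szw) => // /sides_setTP[_].
  by move: (ltn_ord k) zx xw out; clear; lia.
have Az : z \in A.
  apply/negPn/negP => Nz; have zb := neq_val _ _ _ Aa Nz.
  have [||z1 [t [Szt _ [a1 z1z zt tx]]]] := side_around Nz Aa Ax;
    [by move: zb az; clear=> /=; lia|by []|].
  case: (sA _ _ Szt) => [/sides_setTP[_]|Dzt].
    by move: (ltn_ord w) z1z zt tx xw; clear; lia.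
  by move: (noncrossingP ncD Dzt Dzw) z1z zt tx xw; clear; lia.
have Aw : w \in A.
  apply/negPn/negP => Nw; have zb := neq_val _ _ _ Ab Nw.
  have [||z1 [t [Szt _ [a1 z1z zt tx]]]] := side_around Nw Ax Ab;
    [by []|by move: zb wb; clear=> /=; lia|].
  case: (sA _ _ Szt) => [/sides_setTP[_]|Dzt]; first by move: z1z zt a1 zx; clear; lia.
  by move: (noncrossingP ncD Dzw Dzt) z1z zt a1 zx; clear; lia.
(* If all of [A] lay between [z] and [w], then [a = z] and [b = w], which leaves no room for [k]. *)
have [_ _ _ [H|H]] := sidesP _ _ _ (dA _ _ Az Aw zw Dzw).
  by move: (H x Ax) zx xw; clear; lia.
by move: (hB k Bk) (H a Aa) (H b Ab) out az wb; clear; lia.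
Qed.

(** The least and greatest vertices of [A] span a side of [A]. A third vertex lies between them, so
    this side is the one joining [0] and [n], or a chord. *)
Lemma subpolygon_base n (D : {set 'I_n.+1 * 'I_n.+1}) (A : {set 'I_n.+1}) :
  A \in subpolygons D -> exists a b : 'I_n.+1,
    [/\ a \in A, b \in A, forall k, k \in A -> a <= k <= b &
        (a = ord0 /\ b = ord_max) \/ (a, b) \in D].
Proof.
move=> /subpolygonsP[cA sA _].
have [x Ax _] := @third_element _ A ord0 ord0 cA.
case: (@arg_minnP _ x (mem A) val Ax) => a Aa min_a.
case: (@arg_maxnP _ x (mem A) val Ax) => b Ab max_b.
have hA k : k \in A -> a <= k <= b.
  by move=> Ak; apply/andP; split; [apply: min_a | apply: max_b].
have [k Ak /andP[ka kb]] := third_element a b cA.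
have ka' : val k != val a by []. have kb' : val k != val b by [].
have ab : a < b by move: (hA k Ak) ka'; clear=> /=; lia.
exists a, b; split=> //.
have /sA[/sides_setTP[_ [E|[E0 En]]]|] : (a, b) \in sides A; last by right.
- by apply/sidesP; split=> //; right.
- by move: ka' kb' (hA k Ak) E; clear=> /=; lia.
- by left; split; apply/val_inj.
Qed.

Definition vset n (p : seq nat) : {set 'I_n.+1} := [set x | val x \in p].

Definition chord_set n (f : chain) : {set 'I_n.+1 * 'I_n.+1} :=
  [set e | (val e.1, val e.2) \in chords f 0].

(** The outer polygon comes first; its base [(0, width f)] plays the part of the side of [P] joining
    the first and last vertices. *)
Definition pieces (f : chain) : seq (seq nat) := corners f 0 :: polys f 0.

Lemma sorted_base p x : sorted ltn p -> x \in p ->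
  (base p).1 <= x <= (base p).2.
Proof.
move=> /(sub_sorted ltnW) sp px; rewrite /base /= -nth0 -nth_last.
have lt_i : index x p < size p by rewrite index_mem.
rewrite -(nth_index 0 px) !(sorted_leq_nth leq_trans leqnn 0 sp) ?inE //; lia.
Qed.

Lemma mem_base p : 0 < size p -> (base p).1 \in p /\ (base p).2 \in p.
Proof. by case: p => //= x p _; rewrite mem_head /base /= mem_last. Qed.

Lemma card_vset n p : uniq p -> (forall x, x \in p -> x < n.+1) ->
  #|vset n p| = size p.
Proof.
move=> up lep.
have us : uniq (pmap insub p : seq 'I_n.+1) by apply: pmap_sub_uniq.
have -> : #|vset n p| = #|(pmap insub p : seq 'I_n.+1)|.
  by apply: eq_card => x; rewrite inE mem_pmap_sub.
rewrite (card_uniqP us) size_pmap_sub; apply/eqP.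
by rewrite -all_count; apply/allP => x /lep.
Qed.

Section Chain.

Variables (n : nat) (f : chain).
Hypotheses (Af : all_pieces (leq 2) f) (lf : 2 <= links f) (wf : width f = n).

Lemma pieces_sorted p : p \in pieces f ->
  [/\ sorted ltn p, 2 < size p & forall x, x \in p -> x < n.+1].
Proof.
rewrite inE => /predU1P[->|Hp].
  rewrite sorted_corners // size_corners; split=> // x /corners_range.
  by rewrite wf.
have [-> ->] := sorted_polys Af Hp; split=> // x /(polys_range Hp).
by rewrite wf.
Qed.

Lemma pieces_base p : p \in pieces f -> base p = (0, n) \/ base p \in chords f 0.
Proof.
rewrite inE => /predU1P[->|Hp]; first by left; rewrite base_corners wf.
by right; apply: map_f.
Qed.

Lemma pieces_side p (x y : nat) : p \in pieces f -> x \in p -> y \in p -> x < y ->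
  (forall k, k \in p -> ~~ (x < k < y)) -> y = x.+1 \/ (x, y) \in chords f 0.
Proof.
rewrite inE => /predU1P[->|Hp]; first exact: corners_side.
exact: polys_side.
Qed.

Lemma pieces_diagonal p (x y : nat) : p \in pieces f -> x \in p -> y \in p ->
  x < y -> (x, y) \in chords f 0 ->
  (forall k, k \in p -> ~~ (x < k < y)) \/ (forall k, k \in p -> x <= k <= y).
Proof.
rewrite inE => /predU1P[->|Hp]; last exact: polys_diagonal.
by move=> _ _ _ He; left=> k; apply: corners_uncovered He.
Qed.

Lemma card_piece p : p \in pieces f -> #|vset n p| = size p.
Proof.
move=> /pieces_sorted[sp _ lep]; apply: card_vset => //.
exact: sorted_uniq ltn_trans ltnn _ sp.
Qed.

Lemma piece_subpolygon p : p \in pieces f -> vset n p \in subpolygons (chord_set n f).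
Proof.
move=> Hp; have [sp p2 lep] := pieces_sorted Hp.
apply/subpolygonsP; split; first by rewrite card_piece.
- move=> x y /sidesP[]; rewrite ![_ \in vset n p]inE => px py lt_xy [] H.
    have [k pk|E|E] := pieces_side Hp px py lt_xy.
    + by have := H (Ordinal (lep _ pk)); rewrite inE; apply.
    + by left; apply/sides_setTP; split=> //; left.
    + by right; rewrite inE.
  (* A side of the second kind joins the least and the greatest vertex. *)
  have Eb : base p = (val x, val y).
    have [p0 p1] := mem_base (ltnW (ltnW p2)).
    have := H (Ordinal (lep _ p0)); have := H (Ordinal (lep _ p1)).
    rewrite !inE => /(_ p1) /= H1 /(_ p0) /= H0.
    have := sorted_base sp px; have := sorted_base sp py.
    by rewrite [base p]surjective_pairing /= => *; congr pair; lia.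
  have [E|Hb] := pieces_base Hp; last by right; rewrite inE -Eb.
  left; apply/sides_setTP; split=> //; right.
  by move: E; rewrite Eb => -[].
- move=> x y; rewrite ![_ \in vset n p]inE [_ \in chord_set _ _]inE => px py lt_xy He.
  apply/sidesP; rewrite ![_ \in vset n p]inE; split=> //.
  case: (pieces_diagonal Hp px py lt_xy He) => H; [left|right] => k;
    rewrite inE; exact: H.
Qed.

Lemma noncrossing_chord_set : {in chord_set n f &, forall e e', ~~ crossing e e'}.
Proof.
move=> e e'; rewrite !inE => He He'; rewrite /crossing.
have := chords_noncrossing Af He He'; have := chords_noncrossing Af He' He.
by rewrite /=; lia.
Qed.

Lemma vset_inj : {in pieces f &, injective (vset n)}.
Proof.
move=> p q /pieces_sorted[sp _ lep] /pieces_sorted[sq _ leq_] /setP E.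
apply: (irr_sorted_eq ltn_trans ltnn) => // x.
apply/idP/idP => Hx.
  by have := E (Ordinal (lep _ Hx)); rewrite !inE /= Hx => /esym.
by have := E (Ordinal (leq_ _ Hx)); rewrite !inE /= Hx.
Qed.

(** Already the bases of the pieces are distinct. *)
Lemma uniq_pieces : uniq (map (vset n) (pieces f)).
Proof.
rewrite (map_inj_in_uniq vset_inj); apply: (@map_uniq _ _ base).
rewrite /pieces /= -/(chords f 0) uniq_chords // andbT base_corners.
exact: full_chord_notin.
Qed.

(** By [subpolygon_base] every subpolygon shares its base with some piece; [subpolygons_subset],
    used in both directions, shows that the base determines the subpolygon. *)
Lemma subpolygons_chord_set : subpolygons (chord_set n f) =i map (vset n) (pieces f).
Proof.
move=> A; apply/idP/mapP => [SA|[p Hp ->]]; last exact: piece_subpolygon.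
have [a [b [Aa Ab hA Hab]]] := subpolygon_base SA.
have [p Hp Ep] : exists2 p, p \in pieces f & base p = (val a, val b).
  case: Hab => [[-> ->]|].
    by exists (corners f 0); rewrite ?mem_head // base_corners wf.
  rewrite inE => /mapP[p Hp Ep]; exists p => //.
  by rewrite inE Hp orbT.
exists p => //; have Sp := piece_subpolygon Hp.
have [sp p2 lep] := pieces_sorted Hp.
have [p0 p1] := mem_base (ltnW (ltnW p2)); rewrite Ep /= in p0 p1.
have hp k : k \in vset n p -> a <= k <= b.
  by rewrite inE => /(sorted_base sp); rewrite Ep.
apply/eqP; rewrite eqEsubset.
by rewrite !(subpolygons_subset noncrossing_chord_set (a := a) (b := b)) // inE.
Qed.

Lemma card_subpolygons (P : pred {set 'I_n.+1}) :
  #|[set A in subpolygons (chord_set n f) | P A]| =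
  count (fun p => P (vset n p)) (pieces f).
Proof.
rewrite -(count_map (vset n) P) -size_filter.
rewrite -(card_uniqP (filter_uniq P uniq_pieces)); apply: eq_card => A.
by rewrite in_set mem_filter -subpolygons_chord_set andbC.
Qed.

End Chain.

(** * Chains from noncrossing chords *)

Lemma links_ge2 c i : 2 <= width c -> (i, i + width c) \notin chords c i ->
  2 <= links c.
Proof.
case: c => [|[|g|c g]|c [|g|c' g]] //=; rewrite ?addn0 => _.
by rewrite chords_Piece mem_head.
Qed.

(** The chain is read from the left: its first link is a side if no chord starts at [i], and
    otherwise the longest chord starting there. *)
Lemma chain_of_chords (D : seq (nat * nat)) (i j : nat) : i <= j ->
    {in D, forall e, [/\ i <= e.1, e.1.+1 < e.2 & e.2 <= j]} ->
    {in D &, forall e e', ~~ [&& e.1 < e'.1, e'.1 < e.2 & e.2 < e'.2]} ->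
  exists f, [/\ width f = j - i, all_pieces (leq 2) f & chords f i =i D].
Proof.
(* Passing a side may lower only the width, and going under a chord may lower only the number of
   chords, whence the sum as measure. *)
move: {2}(size D + (j - i)) (leqnn (size D + (j - i))) => N.
elim: N D i j => [|N IH] D i j szD le_ij rD ncD.
  have Ej : j - i = 0 by lia.
  exists Stop; rewrite Ej; split=> //.
  by have /nilP-> : nilp D by rewrite /nilp; lia.
have [Ej|lt_ij] := eqVneq i j.
  exists Stop; rewrite -Ej subnn; split=> // e; apply/esym/negP => /rD[].
  by rewrite -Ej; lia.
have {}lt_ij : i < j by lia.
have [/hasP[[i' k0] De0 /eqP /= Ei']|noi] := boolP (has (fun e => e.1 == i) D); last first.
  have [||e De|g [Wg Ag Cg]] := IH D i.+1 j _ _ _ ncD; [lia|by []| |].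
    have [? ? ?] := rD e De; split=> //.
    by have /= := hasPn noi e De; lia.
  by exists (Side g); split=> //=; lia.
have exk : exists k, (i, k) \in D by exists k0; rewrite -Ei'.
have bk k : (i, k) \in D -> k <= j by case/rD.
case: (ex_maxnP exk bk) => k Dk max_k.
have [/= _ lt_ik le_kj] := rD _ Dk.
pose D1 : seq (nat * nat) := [seq e : nat * nat <- D | (e.2 <= k) && (e != (i, k))].
pose D2 : seq (nat * nat) := [seq e : nat * nat <- D | k <= e.1].
have sz1 : size D1 < size D.
  rewrite size_filter -(count_predC (fun e => (e.2 <= k) && (e != (i, k))) D).
  rewrite -[X in X < _]addn0 ltn_add2l -has_count; apply/hasP; exists (i, k) => //=.
  by rewrite eqxx andbF.
have sz2 : size D2 <= size D by rewrite size_filter count_size.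
have [||||c [Wc Ac Cc]] := IH D1 i k.
- by move: sz1 szD le_kj lt_ik; clear; lia.
- by lia.
- move=> e; rewrite mem_filter => /andP[/andP[e2 _] /rD[? ? _]]; split=> //.
- by move=> e e'; rewrite !mem_filter => /andP[_ ?] /andP[_ ?]; apply: ncD.
have [||||g [Wg Ag Cg]] := IH D2 k j.
- by move: sz2 szD le_kj lt_ik; clear; lia.
- by [].
- by move=> e; rewrite mem_filter => /andP[? /rD[? ? ?]]; split.
- by move=> e e'; rewrite !mem_filter => /andP[_ ?] /andP[_ ?]; apply: ncD.
have Ek : i + width c = k by lia.
exists (Piece c g); split.
- by rewrite /=; lia.
(* The chord [(i, k)] was left out of [D1], so the chain below it has more than one link. *)
- rewrite /= Ac Ag !andbT; apply: (@links_ge2 c i); first by lia.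
  by rewrite Ek Cc mem_filter eqxx andbF.
move=> e; rewrite chords_Piece inE mem_cat Ek Cc Cg !mem_filter.
have [->|ne] := eqVneq e (i, k); first by rewrite Dk.
(* By the choice of [k] and noncrossing, every other chord ends at or before [k], or starts at or
   after it. *)
rewrite /= andbT -andb_orl andb_idl // => De.
case: e De {ne} => u v De; have [/= iu _ _] := rD _ De.
have /= := ncD _ _ Dk De; have := max_k v.
have [Eu|ui] := eqVneq u i; first by rewrite -{1}Eu => /(_ De) ->.
by move: iu ui => /= ? /eqP ? _; lia.
Qed.

(** * Notched 3d-dissections as chains with two links *)

Lemma sub_all_pieces (P P' : pred nat) f : subpred P P' ->
  all_pieces P f -> all_pieces P' f.
Proof.
by move=> sP; elim: f => //= c IHc g IHg /and3P[/sP -> /IHc -> /IHg].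
Qed.

Lemma is3d_ge2 : subpred is3d (leq 2).
Proof. by move=> [|[|r]]. Qed.

Lemma all_pieces_is3dP f i :
  reflect {in polys f i, forall p, 3 %| size p} (all_pieces is3d f).
Proof.
apply: (iffP idP); elim: f i => [|g IH|c IHc g IHg] i //=; try exact: IH.
  case/and3P=> /eqP l3 Ac Ag p; rewrite inE mem_cat.
  case/predU1P=> [->|/orP[/(IHc _ Ac)|/(IHg _ Ag)]] //.
  by rewrite size_corners; lia.
move=> H; apply/and3P; split.
- have := H _ (mem_head _ _); rewrite size_corners /is3d; lia.
- by apply: (IHc i) => p Hp; apply: H; rewrite inE mem_cat Hp orbT.
- by apply: (IHg (i + width c)) => p Hp; apply: H; rewrite inE mem_cat Hp !orbT.
Qed.

(** The leading [Side] joins [0] to [1] and [f] lives on [1, ..., n], so index [j] stands for vertex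
    [j + 1]. The outer polygon has four corners and is not counted, whence [b = 0]. *)
Lemma quiddity_chord_set n f (j : 'I_n) :
    all_pieces is3d f -> links f = 2 -> (width f).+1 = n ->
  quiddity (chord_set n (Side f)) j = nth 0 (weights 0 f) j.
Proof.
move=> A3 l2 wf; have Af := sub_all_pieces is3d_ge2 A3.
have lF : 2 <= links (Side f) by rewrite /= l2.
rewrite /quiddity (@card_subpolygons n (Side f) Af lF wf
  (fun A => (3 %| #|A|) && (lift ord0 j \in A))).
have card_p := @card_piece n (Side f) Af lF wf.
rewrite (nth_weights 0 1) // mul0n add0n /pieces [count _ _]/=.
rewrite -[vset n _]/(vset n (corners (Side f) 0)) card_p ?mem_head //.
rewrite size_corners /= l2 /= add0n; apply: eq_in_count => p Hp.
rewrite card_p ?(all_pieces_is3dP f 1 A3) //; last by rewrite inE Hp orbT.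
by rewrite inE [val _]lift0 add1n.
Qed.

Lemma Posz_weights n (a : n.-tuple int) f : n = (width f).+1 ->
  (forall j : 'I_n, tnth a j = Posz (nth 0 (weights 0 f) j)) <->
  map Posz (weights 0 f) = a.
Proof.
move=> En; split=> [H|H j]; last first.
  rewrite (tnth_nth 0%R) -H (nth_map 0) // size_weights -En; exact: ltn_ord.
apply: (@eq_from_nth _ 0%R); first by rewrite size_map size_weights size_tuple.
move=> k; rewrite size_map size_weights -En => lt_k.
rewrite (nth_map 0) ?size_weights -?En //.
by rewrite -[k]/(val (Ordinal lt_k)) -H (tnth_nth 0%R).
Qed.

Lemma diagonalsP n (D : {set 'I_n.+1 * 'I_n.+1}) :
  reflect (forall x y, (x, y) \in D -> x.+1 < y /\ (val x, val y) != (0, n))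
          (D \subset diagonals [set: 'I_n.+1]).
Proof.
apply: (iffP subsetP) => H.
  move=> x y /H; rewrite in_setD => /andP[Ns]; rewrite !inE /= => lt_xy.
  split.
    by rewrite ltn_neqAle lt_xy andbT; apply: contraNneq Ns => E;
      apply/sides_setTP; split=> //; left.
  by apply: contraNneq Ns => -[E1 E2]; apply/sides_setTP; split=> //; right.
move=> [x y] /H[lt_xy ne]; rewrite in_setD !inE /= (ltnW lt_xy) andbT.
apply/negP => S; have /sides_setTP[_ [E|[E1 E2]]] : (x, y) \in sides [set: 'I_n.+1].
- by rewrite !inE /= (ltnW lt_xy).
- by move: lt_xy; rewrite E ltnn.
- by move: ne; rewrite /= E1 E2 eqxx.
Qed.

(** A [Side] as first or last link would leave that end of the chain in no piece, with weight 0. *)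
Lemma weights0_positive f : links f = 2 -> all (leq 1) (weights 0 f) ->
  exists c1 c2, f = Piece c1 (Piece c2 Stop).
Proof.
case: f => [//|g|c1 [//|g|c2 [|//|//]]] //=; last by exists c1, c2.
case: g => // _.
have E0 : nth 0 (glue (weights 1 c1) [:: 0; 0]) (width c1).+1 = 0.
  rewrite nth_glue ?weights_neq0 // size_weights nth_default ?size_weights //=.
  by rewrite ltnNge leqnSn subSnn.
have : nth 0 (glue (weights 1 c1) [:: 0; 0]) (width c1).+1
    \in glue (weights 1 c1) [:: 0; 0].
  by rewrite mem_nth // size_glue ?weights_neq0 // size_weights /=; lia.
rewrite E0; case: (glue _ _) => [|x s] //=; rewrite add0n => x0 pos.
by have /allP/(_ _ x0) : all (leq 1) (x :: s) by [].
Qed.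

Lemma vset_root_subpolygons n f : all_pieces is3d f -> links f = 2 ->
    (width f).+1 = n ->
  let Q := vset n (corners (Side f) 0) in
  [/\ Q \in subpolygons (chord_set n (Side f)), #|Q| = 4 &
      {in subpolygons (chord_set n (Side f)), forall A, A != Q -> 3 %| #|A|}].
Proof.
move=> A3 l2 wf; have Af := sub_all_pieces is3d_ge2 A3.
have lF : 2 <= links (Side f) by rewrite /= l2.
split.
- by apply: (@piece_subpolygon n (Side f)); rewrite ?mem_head.
- by rewrite (@card_piece n (Side f)) ?mem_head //= size_corners l2.
- move=> A; rewrite (@subpolygons_chord_set n (Side f)) // => /mapP[p Hp ->].
  move: (Hp); rewrite inE => /predU1P[->|Hp' _]; first by rewrite eqxx.
  by rewrite (@card_piece n (Side f)) // (all_pieces_is3dP f 1 A3).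
Qed.

Lemma sides_at0 n (e : 'I_n.+1 * 'I_n.+1) : 2 <= n ->
  e \in sides [set: 'I_n.+1] -> (ord0 == e.1) || (ord0 == e.2) ->
  e \in [set (ord0, inord 1); (ord0, ord_max)].
Proof.
case: e => x y n2 /sides_setTP[lt_xy H] /=.
rewrite !inE !xpair_eqE -!val_eqE /= inordK; last by lia.
by move: lt_xy H; clear -n2; lia.
Qed.

(** The quadrilateral has vertices [0], [1], [width c1 + 1] and [n]. Both widths are at least 2, so
    [n >= 5] and its sides away from [0] are diagonals of [P]. *)
Lemma notched_chord_set n c1 c2 (f := Piece c1 (Piece c2 Stop)) :
  all_pieces is3d f -> (width f).+1 = n ->
  notched_3d_dissection (chord_set n (Side f)) ord0.
Proof.
move=> A3 wf; have Af := sub_all_pieces is3d_ge2 A3.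
have [w1 w2] : 2 <= width c1 /\ 2 <= width c2.
  move: Af => /= /and3P[l1 /links_width lw1 /and3P[l2 /links_width lw2 _]].
  by split; lia.
have En : n = (width c1 + width c2).+1 by rewrite -wf /= addn0.
have Af' : all_pieces (leq 2) (Side f) by [].
have [SQ cQ Q3] := vset_root_subpolygons A3 erefl wf.
set Q := vset n _ in SQ cQ Q3.
split.
- by rewrite En; lia.
- split; last exact: noncrossing_chord_set.
  apply/diagonalsP => x y; rewrite inE => /(@chords_range f 1 _ Af)[/= ? ? ?].
  by split=> //; rewrite xpair_eqE; lia.
have memQ (x : 'I_n.+1) : (x \in Q) =
    [|| x == 0 :> nat, x == 1 :> nat, x == (width c1).+1 :> nat | x == n :> nat].
  have En' : 1 + width c1 + width c2 = n by rewrite En.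
  by rewrite inE /= !inE En'.
have root_sides (e : 'I_n.+1 * 'I_n.+1) :
    e \in sides Q :&: sides [set: 'I_n.+1] -> (ord0 == e.1) || (ord0 == e.2).
  case: e => x y /setIP[/sidesP[]]; rewrite !memQ => Qx Qy _ _ /sides_setTP[lt_xy H].
  rewrite -!val_eqE /=; move: Qx Qy lt_xy H; clear -w1 w2 En; lia.
exists Q; split.
- apply/setP => A; rewrite in_set in_set1; apply/andP/eqP => [[SA /eqP cA]|->].
    by apply/eqP/negPn/negP => /(Q3 A SA); rewrite cA.
  by rewrite SQ cQ.
- exact: Q3.
- have -> : sides Q :&: sides [set: 'I_n.+1] = [set (ord0, inord 1); (ord0, ord_max)].
    apply/eqP; rewrite eqEsubset; apply/andP; split; apply/subsetP => -[x y].
      by move=> S; apply: sides_at0; [lia | case/setIP: S | exact: root_sides S].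
    rewrite in_set2 !xpair_eqE -!val_eqE /= inordK; last by clear -w1 w2 En; lia.
    move=> Exy; have [x0 Ey] : x = 0 :> nat /\ (y = 1 :> nat \/ y = n :> nat).
      by move: Exy; clear; lia.
    apply/setIP; split; last first.
      apply/sides_setTP; move: x0 Ey; clear -w1 w2 En; lia.
    apply/sidesP; rewrite !memQ; split.
    + by move: x0; clear; lia.
    + by move: Ey; clear; lia.
    + by move: x0 Ey; clear -w1 w2 En; lia.
    case: Ey => Ey; [left|right] => k; rewrite x0 Ey; first by clear; lia.
    by have := ltn_ord k; clear; lia.
  rewrite cards2 xpair_eqE eqxx -val_eqE /= inordK; last by clear -w1 w2 En; lia.
  by rewrite (_ : 1 == n = false) //; clear -w1 w2 En; lia.
- by move=> e /root_sides.
Qed.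

Lemma chain_of_notched n (D : {set 'I_n.+1 * 'I_n.+1}) :
  notched_3d_dissection D ord0 ->
  exists f, [/\ all_pieces is3d f, links f = 2, (width f).+1 = n &
                 D = chord_set n (Side f)].
Proof.
case=> n5 [/diagonalsP dD ncD] [Q [SQ Q3 cS S0]].
pose Ds : seq (nat * nat) := [seq (val e.1, val e.2) | e <- enum D].
have memDs (x y : 'I_n.+1) : ((val x, val y) \in Ds) = ((x, y) \in D).
  apply/mapP/idP => [[[x' y'] + [E1 E2]]|Dxy]; last first.
    by exists (x, y); rewrite ?mem_enum.
  by rewrite mem_enum (val_inj E1) (val_inj E2).
have DsP e : e \in Ds -> exists x y : 'I_n.+1, (x, y) \in D /\ e = (val x, val y).
  by case/mapP => -[x y]; rewrite mem_enum => Dxy ->; exists x, y.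
have [|||F [wF AF CF]] := @chain_of_chords Ds 0 n.
- by [].
- move=> e /DsP[x [y [/dD[lt_xy _] ->]]]; split=> //=.
  by rewrite -ltnS.
- move=> e e' /DsP[x [y [Dxy ->]]] /DsP[z [w [Dzw ->]]] /=.
  exact: noncrossingP ncD Dxy Dzw.
rewrite subn0 in wF.
have ED : D = chord_set n F.
  by apply/setP => -[x y]; rewrite inE CF memDs.
have nfull : (0, width F) \notin chords F 0.
  rewrite wF CF -[0]/(val (@ord0 n)) -[X in (_, X)]/(val (@ord_max n)) memDs.
  by apply/negP => /dD[_]; rewrite eqxx.
have lF : 2 <= links F by apply: (@links_ge2 F 0); [lia|].
have [SQD cQ] : Q \in subpolygons D /\ #|Q| = 4.
  by have : Q \in [set Q] := set11 Q; rewrite -SQ in_set => /andP[-> /eqP].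
(* Only two sides of [P] pass through [0], and [Q] has two sides among them. *)
have ES : sides Q :&: sides [set: 'I_n.+1] = [set (ord0, inord 1); (ord0, ord_max)].
  apply/eqP; rewrite eqEcard cS cards2; apply/andP; split.
    apply/subsetP => e Se; apply: sides_at0; [lia|by case/setIP: Se|exact: S0].
  by case: (_ != _).
have /setIP[/sidesP[Q0 Q1 _ _] _] : (ord0, inord 1) \in sides Q :&: sides [set: 'I_n.+1].
  by rewrite ES set21.
have /setIP[/sidesP[_ Qn _ _] _] : (ord0, ord_max) \in sides Q :&: sides [set: 'I_n.+1].
  by rewrite ES set22.
have := SQD; rewrite ED subpolygons_chord_set // => /mapP[p Hp EQ].
have [sp _ lep] := pieces_sorted AF lF wF Hp.
move: Q0 Q1 Qn; rewrite EQ !inE /= inordK; last by lia.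
move=> p0 p1 pn.
(* As [Q] contains [0] and [n], any piece other than the outer polygon would be cut off by the chord
   [(0, n)], which is a side of [P]. *)
have Ep : p = corners F 0.
  move: (Hp); rewrite inE => /predU1P[//|Hp'].
  case/negP: nfull; suff <- : base p = (0, width F) by apply: map_f.
  have p_gt0 : 0 < size p by case: (p) p0.
  have [b0 b1] := mem_base p_gt0.
  rewrite [base p]surjective_pairing wF; congr pair.
    by have := sorted_base sp p0; lia.
  by have := sorted_base sp pn; have := lep _ b1; lia.
have l3 : links F = 3.
  by apply/eqP; rewrite -eqSS -(size_corners F 0) -Ep -(card_piece AF lF wF Hp) -EQ cQ.
(* Vertex [1] is a corner, and a first link of width at least 2 would skip it. *)
have [f EF] : exists f, F = Side f.
  move: p1; rewrite Ep; case: (F) l3 AF => [//|f _ _ _|c g _]; first by exists f.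
  move=> /= /and3P[l2 /links_width wc _].
  by rewrite inE /= => /corners_range; lia.
move: AF l3 wF ED Hp Ep EQ lF; rewrite EF => AF [l2] wF ED Hp Ep EQ lF.
exists f; split=> //; apply/(all_pieces_is3dP f 1) => q Hq.
have Hq' : q \in pieces (Side f) by rewrite inE Hq orbT.
rewrite -(card_piece AF lF wF Hq'); apply: Q3.
  by rewrite ED (piece_subpolygon AF lF wF).
rewrite EQ; apply: contraTneq Hq => /(vset_inj AF lF wF Hq' Hp) ->.
by have /andP[] := map_uniq (uniq_pieces AF lF wF); rewrite Ep.
Qed.

Local Open Scope ring_scope.

Theorem mainTheorem1 (n : nat) (a : n.-tuple int) (n_ge1 : (1 <= n)%N)
    (a_gt0 : forall i : 'I_n, 0 < tnth a i) :
  (M_mx a = S_mx \/ M_mx a = - S_mx) <->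
  (exists D : {set 'I_n.+1 * 'I_n.+1},
     notched_3d_dissection D ord0 /\ is_quiddity D a).
Proof.
split=> [HM|[D [HD Hq]]].
  pose s := [seq absz x | x <- a].
  have Es : map Posz s = a.
    rewrite -map_comp -[RHS]map_id; apply/eq_in_map => x /tnthP[i ->] /=.
    by rewrite gez0_abs // ltW.
  have ps : all (leq 1) s.
    apply/allP => _ /mapP[x /tnthP[i ->] ->].
    by rewrite absz_gt0 gt_eqF.
  have [f [Wf A3 l2]] := chain_of_S ps (proj1 (M_mx_S Es) HM).
  have wf : (width f).+1 = n by rewrite -(size_weights 0) Wf size_map size_tuple.
  exists (chord_set n (Side f)); split.
    have [c1 [c2 Ef]] : exists c1 c2, f = Piece c1 (Piece c2 Stop).
      by apply: weights0_positive; rewrite ?Wf.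
    by move: A3 wf; rewrite Ef; apply: notched_chord_set.
  move=> j; rewrite quiddity_chord_set //.
  by apply: (proj2 (Posz_weights a (esym wf)) _ j); rewrite Wf.
have [f [A3 l2 wf ED]] := chain_of_notched HD.
apply/(M_mx_S (s := weights 0 f)).
  apply/(Posz_weights a (esym wf)) => j.
  by rewrite Hq ED quiddity_chord_set.
(* Three corners of weight 0 remain, and [S ^ 3 = - S]. *)
apply: eqpm_trans (act_weights 0 A3) _; rewrite l2; right => v.
by case: v => u w; rewrite /step /opp2 /=; congr pair; ring.
Qed.
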